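(* Let $\Psi(z) = \gamma\bar{z} + \psi(z)$ where $\gamma \in \mathbb{C} \setminus \{0\}$ and $\psi$ is analytic on an open neighborhood of the closed unit disc $\overline{\mathbb{D}}$. Define the associated meromorphic function $R(z) = \gamma/z + \psi(z)$. If $\lambda\in\mathbb{C}$ satisfies $\lambda \notin R(\overline{\mathbb{D}})$, then $\lambda \in \sigma_p(T_\Psi)$, where $T_\Psi$ acts on the Bergman space $L_A^2(\mathbb{D})$, and the corresponding eigenfunction is given by $$f_\lambda(z) = \exp\left( - \int_{0}^{z} \frac{\omega\psi'(\omega) + 2(\psi(\omega)-\lambda)}{\gamma + \omega(\psi(\omega) - \lambda)} \, d\omega \right) \in H^\infty(\mathbb{D}) \subset L_A^2(\mathbb{D}).$$
   Context: $\mathbb{D} = \{z \in \mathbb{C} : |z| < 1\}$ and $\overline{\mathbb{D}}$ is its closure. The function $R$ has a pole at $0$ with $R(0)=\infty$, so for $\lambda\in\mathbb{C}$, $\lambda \notin R(\overline{\mathbb{D}})$ means $R(z)\ne\lambda$ for all $z\in\overline{\mathbb{D}}\setminus\{0\}$. The Bergman space $L_A^2(\mathbb{D}) = L^2(\mathbb{D}, dA) \cap \mathcal{H}(\mathbb{D})$ consists of the analytic functions on $\mathbb{D}$ that are square-integrable with respect to the normalized area measure $dA(z) = \frac{1}{\pi}\,dx\,dy$; $P : L^2(\mathbb{D}, dA) \to L_A^2(\mathbb{D})$ is the orthogonal (Bergman) projection, $Pf(z)= \int_{\mathbb{D}} \frac{f(\omega)}{(1-\bar{\omega}z)^{2}}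 \, dA(\omega)$. For $\phi \in L^\infty(\mathbb{D})$, the Toeplitz operator on $L_A^2(\mathbb{D})$ is $T_{\phi}f = P(\phi f)$. $\sigma_p(T)$ denotes the point spectrum (set of eigenvalues) of $T$. $H^\infty(\mathbb{D})$ is the space of bounded analytic functions on $\mathbb{D}$. *)

(* Defs.v *)
From mathcomp Require Import all_boot all_order all_algebra.
From mathcomp Require Import all_classical all_reals all_analysis.
From mathcomp Require Import complex.
Import Order.TTheory GRing.Theory Num.Theory numFieldNormedType.Exports.

Set Implicit Arguments.
Unset Strict Implicit.
Unset Printing Implicit Defensive.

Local Open Scope classical_set_scope.
Local Open Scope complex_scope.
Local Open Scope ring_scope.

(* [R[i]^o] is the complex plane as a normed space over the field [R[i]]; its
   norm [`|z|] is the modulus, as an element of [R[i]]. *)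
Definition unit_disc (R : realType) : set R[i]^o := [set z | `|z| < 1].

(* Differentiability over the scalar field [R[i]], i.e. complex
   differentiability; meant for open [U]. *)
Definition holomorphic_on (R : realType) (U : set R[i]^o)
    (f : R[i]^o -> R[i]^o) : Prop :=
  forall z, U z -> derivable f z 1.

Definition complex_integral (d : measure_display) (T : measurableType d)
    (R : realType) (mu : {measure set T -> \bar R}) (D : set T)
    (f : T -> R[i]) : R[i] :=
  (\int[mu]_(t in D) complex.Re (f t))%R +i*
  (\int[mu]_(t in D) complex.Im (f t))%R.

(* [R[i]] carries no measurable structure in the library: functions of a
   complex variable are integrated over [R * R] through [cplx]. *)
Notation plane R := (measurableTypeR R * measurableTypeR R)%type.

Definition cplx (R : realType) (p : plane R) : R[i] := p.1 +i* p.2.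

Lemma invr_pi_ge0 (R : realType) : 0 <= (pi : R)^-1.
Proof. by rewrite invr_ge0 pi_ge0. Qed.

Definition dA (R : realType) : {measure set (plane R) -> \bar R} :=
  mscale (NngNum (invr_pi_ge0 R)) (lebesgue_measure \x lebesgue_measure)%E.

Definition area_integral (R : realType) (f : R[i] -> R[i]) : R[i] :=
  complex_integral (@dA R) (@cplx R @^-1` @unit_disc R) (f \o @cplx R).

(* Functions on the disc are represented by functions on [R[i]]; their values
   outside the disc are irrelevant. *)
Definition square_integrable (R : realType) (f : R[i] -> R[i]) : Prop :=
  let D := @cplx R @^-1` @unit_disc R in
  [/\ measurable_fun D (fun p => complex.Re (f (cplx p))),
      measurable_fun D (fun p => complex.Im (f (cplx p))) &
      (\int[@dA R]_(p in D) (complex.Re (`|f (cplx p)| ^+ 2))%:E < +oo)%E].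

Definition bergman_space (R : realType) : set (R[i] -> R[i]) :=
  [set f | square_integrable f /\ holomorphic_on (@unit_disc R) f].

Definition Hinfty (R : realType) : set (R[i] -> R[i]) :=
  [set f | holomorphic_on (@unit_disc R) f /\
           exists M : R[i], forall z, unit_disc z -> `|f z| <= M].

Definition bergman_projection (R : realType) (f : R[i] -> R[i]) :
    R[i] -> R[i] :=
  fun z => area_integral (fun w => f w / (1 - w^*%C * z) ^+ 2).

Definition toeplitz (R : realType) (phi : R[i] -> R[i]) (f : R[i] -> R[i]) :
    R[i] -> R[i] :=
  bergman_projection (fun w => phi w * f w).

(* For an operator [T] on the Bergman space; equality and nonvanishing of
   functions are meant on the disc. *)
Definition eigenfunction (R : realType) (T : (R[i] -> R[i]) -> (R[i] -> R[i]))
    (l : R[i]) (f : R[i] -> R[i]) : Prop :=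
  [/\ bergman_space f, exists2 z, unit_disc z & f z != 0 &
      forall z, unit_disc z -> T f z = l * f z].

Definition point_spectrum (R : realType)
    (T : (R[i] -> R[i]) -> (R[i] -> R[i])) : set R[i] :=
  [set l | exists f, eigenfunction T l f].

Definition complex_exp (R : realType) (z : R[i]) : R[i] :=
  (expR (complex.Re z))%:C *
  (cos (complex.Im z) +i* sin (complex.Im z)).

(* Integral of [g] from 0 to [z] along the segment [w = t z]; when [g] is
   holomorphic on a disc centred at 0 any other path in that disc gives the same value. *)
Definition integral_from0 (R : realType) (g : R[i] -> R[i]) (z : R[i]) : R[i] :=
  complex_integral lebesgue_measure `[0, 1] (fun t : R => g (t%:C * z) * z).

(* The harmonic symbol [gamma * conj z + psi z]. *)
Definition symbol (R : realType) (gamma : R[i]) (psi : R[i] -> R[i]) :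
    R[i] -> R[i] :=
  fun z => gamma * z^*%C + psi z.

(* Used away from the pole 0 only. *)
Definition assoc_mero (R : realType) (gamma : R[i]) (psi : R[i] -> R[i]) :
    R[i] -> R[i] :=
  fun z => gamma / z + psi z.

Definition eigen_candidate (R : realType) (gamma : R[i])
    (psi : R[i]^o -> R[i]^o) (lambda : R[i]) : R[i] -> R[i] :=
  fun z => complex_exp (- integral_from0 (fun w : R[i] =>
    (w * 'D_1 psi w + 2 * (psi w - lambda)) /
    (gamma + w * (psi w - lambda))) z).

(* Main.v *)
(* Let [f] be the candidate, [g] the integrand in its exponent and
   [q w = gamma + w (psi w - lambda)], which has no zero near the closed disc
   because [lambda] is not a value of [R] there. Then [f' = - g f] and
   [(f q)' = - (psi - lambda) f].

   Green's formula turns the area integral of [h(w) k'(conj w)], for [h] and [k]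
   holomorphic near the closed disc, into [1/2] times the integral over
   [-pi <= t <= pi] of [h(e) k(conj e) e], where [e = e^(it)]. Applied to the
   Bergman kernel [1 / (1 - u z)^2], which has primitive [u / (1 - u z)], it
   expresses [T_Psi f (z)] as a circle integral, and by Cauchy's formula the same
   is true of [lambda f(z)]. As [conj e = 1 / e], the difference of the two
   integrands is the [t]-derivative of [- i m(conj e) e f(e) q(e)], where
   [m' (u) = - u / (1 - u z)] and [m 0 = 0], and hence integrates to [0] by
   periodicity. *)

Require Import Defs.
From mathcomp Require Import all_boot all_order all_algebra.
From mathcomp Require Import all_classical all_reals all_analysis.
From mathcomp Require Import complex ring lra.
Import Order.TTheory GRing.Theory Num.Theory numFieldNormedType.Exports.
Import Normc.
Local Notation Re := complex.Re.
Local Notation Im := complex.Im.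

Set Implicit Arguments.
Unset Strict Implicit.
Unset Printing Implicit Defensive.

Local Open Scope classical_set_scope.
Local Open Scope complex_scope.
Local Open Scope ring_scope.

(** * The complex plane *)

(** Holomorphy here is bare complex differentiability, while the integrand [g] contains [psi'] and
    Green's formula needs continuous derivatives. The regularity of [psi'] therefore has to be
    earned. Goursat's theorem provides primitives. A primitive has a continuous derivative, which is
    enough for a homotopy proof of Cauchy's formula, and differentiating the resulting Cauchy
    integral shows that derivatives of holomorphic functions are again holomorphic.

    The coefficient 2 in the numerator of [g] is forced. Put p = psi - lambda; since q' = p + w
    psi', the numerator is q' + p, so q' - g q = -p. In the boundary identity the terms carrying [m]
    then combine to q - w p = gamma, which is the coefficient of conj w in the symbol.

    Two radii beyond 1 are used. Compactness of the closed disc gives r > 1 such that [psi] is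
    holomorphic and [q] has no zero where |w| < r. The kernel 1 / (1 - u z)^2 is singular at u = 1 /
    z, so each [z] needs its own s with 1 < s <= r and s |z| < 1. *)

Section ComplexPlane.
Context {R : realType}.
Local Notation C := (R[i]^o).
Implicit Types (z w : C).

(** The norm takes values in [R[i]], which is only partially ordered; estimates are carried out on
    the real number [normc z] instead. *)
Lemma normrE_normc (z : R[i]) : `|z| = (normc z)%:C.
Proof. by rewrite normc_def; case: z. Qed.

Lemma normc_ge0 (z : R[i]) : 0 <= normc z.
Proof. by case: z => a b /=; rewrite sqrtr_ge0. Qed.

Lemma normc_eq0 (z : R[i]) : (normc z == 0) = (z == 0).
Proof. by apply/eqP/eqP => [/eq0_normc //|->]; rewrite normc0. Qed.

Lemma normc_gt0 (z : R[i]) : (0 < normc z) = (z != 0).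
Proof. by rewrite lt_neqAle normc_ge0 andbT eq_sym normc_eq0. Qed.

Lemma ler_normcD (z w : R[i]) : normc (z + w) <= normc z + normc w.
Proof. by rewrite -lecR rmorphD/= -!normrE_normc ler_normD. Qed.

Lemma normcNE (z : R[i]) : normc (- z) = normc z.
Proof. by apply: complexI; rewrite -!normrE_normc normrN. Qed.

Lemma normc_distC (z w : R[i]) : normc (z - w) = normc (w - z).
Proof. by rewrite -normcNE opprB. Qed.

Lemma ler_Re_normc (z : R[i]) : `|Re z| <= normc z.
Proof. by rewrite -lecR -normrE_normc normc_ge_Re. Qed.

Lemma ler_Im_normc (z : R[i]) : `|Im z| <= normc z.
Proof.
case: z => a b /=; rewrite -sqrtr_sqr ler_sqrt ?lerDr ?addr_ge0 ?sqr_ge0//.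
Qed.

Lemma ler_normc_ReIm (z : R[i]) : normc z <= `|Re z| + `|Im z|.
Proof.
case: z => a b /=.
rewrite -[leRHS]ger0_norm ?addr_ge0// -sqrtr_sqr ler_sqrt ?sqr_ge0//.
by rewrite sqrrD !real_normK ?num_real// addrAC lerDl mulrn_wge0// mulr_ge0.
Qed.

Lemma normc_real (r : R) : normc r%:C = `|r|.
Proof. by rewrite /= expr0n/= addr0 sqrtr_sqr. Qed.

(** A positive element of [R[i]] has zero imaginary part, so real tolerances suffice. *)
Lemma cvgcP (T : Type) (F : set_system T) {FF : Filter F} (f : T -> C) (l : C) :
  f @ F --> l <-> forall e : R, 0 < e -> \forall x \near F, normc (l - f x) < e.
Proof.
split=> [/cvgrPdist_lt fl e e0|fl].
  have /fl : 0 < e%:C by rewrite ltcR.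
  by apply: filterS => x; rewrite normrE_normc ltcR.
apply/cvgrPdist_lt => e; rewrite ltcE => /andP[/eqP/= e1 e0].
have -> : e = (Re e)%:C by case: e e1 {e0} => a b /= ->.
have := fl _ e0; apply: filterS => x.
by rewrite normrE_normc ltcR.
Qed.

Lemma cvgc_ReIm (T : Type) (F : set_system T) {FF : Filter F} (f : T -> C) (l : C) :
  (fun x => Re (f x)) @ F --> Re l -> (fun x => Im (f x)) @ F --> Im l ->
  f @ F --> l.
Proof.
move=> /cvgrPdist_lt fr /cvgrPdist_lt fi; apply/cvgcP => e e0.
have e20 : 0 < e / 2 by rewrite divr_gt0.
near=> x.
apply: le_lt_trans (ler_normc_ReIm _) _.
rewrite (splitr e) ltrD// raddfB/=; near: x; [exact: fr|exact: fi].
Unshelve. all: by end_near. Qed.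

Lemma near_normc_lt z (e : R) : 0 < e -> \forall w \near z, normc (z - w) < e.
Proof.
move=> e0; have FF := nbhs_filter z.
by apply/(cvgcP (F := nbhs z) (FF := FF) id z).1 => //; exact: cvg_id.
Qed.

Lemma continuous_Re : continuous (@complex.Re R : C -> R).
Proof.
move=> z; have FF := nbhs_filter z; apply/cvgrPdist_lt => e e0.
have := near_normc_lt z e0; apply: filterS => w; apply: le_lt_trans.
by rewrite -raddfB/= ler_Re_normc.
Qed.

Lemma continuous_Im : continuous (@complex.Im R : C -> R).
Proof.
move=> z; have FF := nbhs_filter z; apply/cvgrPdist_lt => e e0.
have := near_normc_lt z e0; apply: filterS => w; apply: le_lt_trans.
by rewrite -raddfB/= ler_Im_normc.
Qed.

Lemma continuous_real_complex : continuous (fun x : R => x%:C : C).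
Proof.
by move=> x; apply: cvgc_ReIm => /=; [exact: cvg_id|exact: cvg_cst].
Qed.

Lemma continuous_conjc : continuous (fun z : C => z^*%C : C).
Proof.
move=> z; have FF := nbhs_filter z; apply/cvgcP => e e0.
have := near_normc_lt z e0; apply: filterS => w.
suff -> : normc (z - w) = normc (z^*%C - w^*%C) by [].
by rewrite -rmorphB/=; case: (z - w) => a b; rewrite /= sqrrN.
Qed.

Lemma continuous_normc : continuous (@normc R : C -> R).
Proof.
move=> z; have FF := nbhs_filter z; apply/cvgrPdist_lt => e e0.
have := near_normc_lt z e0; apply: filterS => w; apply: le_lt_trans.
have h1 := ler_normcD (z - w) w; have h2 := ler_normcD (w - z) z.
rewrite subrK in h1; rewrite subrK in h2; rewrite (normc_distC w) in h2.
by rewrite ler_norml; apply/andP; split; lra.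
Qed.

Definition cdisc (r : R) : set C := [set z | normc z < r].

Lemma open_cdisc r : open (cdisc r).
Proof.
rewrite (_ : cdisc r = (@normc R : C -> R) @^-1` [set x | x < r])//.
apply: open_comp; last exact: open_lt.
by move=> z _; exact: continuous_normc.
Qed.

Lemma unit_discE : @unit_disc R = cdisc 1.
Proof. by apply/seteqP; split => z /=; rewrite /unit_disc /cdisc /= normrE_normc (ltcR _ 1). Qed.

(** The disc is closed and lies in the image of the compact square [-1, 1]^2 under the continuous
    map [m]. *)
Lemma compact_cdisc : compact [set z : C | normc z <= 1].
Proof.
pose K : set (R * R) := `[-1, 1]%classic `*` `[-1, 1]%classic.
have cK : compact K by apply: compact_setX; exact: segment_compact.
pose m (p : R * R) : C := p.1 +i* p.2.
have cm : continuous m.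
  move=> p; apply: cvgc_ReIm => /=; [exact: cvg_fst|exact: cvg_snd].
apply: (@subclosed_compact _ _ (m @` K)).
- rewrite (_ : [set _ | _] = (@normc R : C -> R) @^-1` [set x | x <= 1])//.
  apply: closed_comp; last exact: closed_le.
  by move=> z _; exact: continuous_normc.
- apply: continuous_compact => //.
  exact: continuous_subspaceT.
- move=> [a b] /= h; exists (a, b) => //.
  have h1 := le_trans (ler_Re_normc (a +i* b)) h.
  have h2 := le_trans (ler_Im_normc (a +i* b)) h.
  by split; rewrite /= in_itv/= -ler_norml.
Qed.

Lemma closure_unit_disc z : normc z <= 1 -> closure (@unit_disc R) z.
Proof.
(* The points (1 - 1/(n+1)) z lie in the open disc and tend to [z]. *)
move=> z1; have ct : (fun n : nat => (1 - (n.+1%:R)^-1)%:C * z : C) @ \oo --> z.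
  rewrite -[X in _ --> X]mul1r; apply: cvgM; last exact: cvg_cst.
  have h : 1 - n.+1%:R^-1 @[n --> \oo] --> (1 : R).
    rewrite -[X in _ --> X]subr0; apply: cvgB; first exact: cvg_cst.
    exact: cvg_harmonic.
  exact: (cvg_comp _ _ h (@continuous_real_complex 1)).
apply: (closed_cvg _ (@closed_closure _ _) _ _ ct); apply: nearW => n.
apply: subset_closure; rewrite unit_discE /cdisc/= normcM normc_real.
have n0 : 0 < n.+1%:R^-1 :> R by rewrite invr_gt0.
have n1 : n.+1%:R^-1 <= 1 :> R by rewrite invf_le1 ?ltr0Sn// ler1n.
rewrite ger0_norm ?subr_ge0//.
apply: (@le_lt_trans _ _ (1 - n.+1%:R^-1)); last by rewrite ltrBlDr ltrDl.
by rewrite ler_piMr ?subr_ge0.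
Qed.

End ComplexPlane.

(** * Complex-valued integrals over intervals *)

Section IntervalIntegral.
Context {R : realType}.
Local Notation C := (R[i]^o).
Local Notation mu := (@lebesgue_measure R).

Definition cint (a b : R) (phi : R -> C) : C := complex_integral mu `[a, b] phi.

Lemma Re_cint a b phi : Re (cint a b phi) = (\int[mu]_(x in `[a, b]) Re (phi x))%R.
Proof. by []. Qed.

Lemma Im_cint a b phi : Im (cint a b phi) = (\int[mu]_(x in `[a, b]) Im (phi x))%R.
Proof. by []. Qed.

Lemma complex_eq (z w : R[i]) : Re z = Re w -> Im z = Im w -> z = w.
Proof. by case: z w => a b [c d] /= -> ->. Qed.

Lemma eq_cint a b (f g : R -> C) : {in `[a, b], f =1 g} -> cint a b f = cint a b g.
Proof.
move=> fg; apply: complex_eq; rewrite ?Re_cint ?Im_cint; apply: eq_Rintegral => x /set_mem/= xab;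
  by rewrite fg.
Qed.

(** Continuity is two-sided even at the end points, so the pointwise rules for limits apply without
    passing to the subspace topology. *)
Definition in_cont (a b : R) (phi : R -> C) := {in `[a, b], continuous phi}.

Lemma in_cont_Re a b phi : in_cont a b phi -> {in `[a, b], continuous (fun x => Re (phi x))}.
Proof. by move=> h x /h hx; apply: (continuous_comp hx); exact: continuous_Re. Qed.

Lemma in_cont_Im a b phi : in_cont a b phi -> {in `[a, b], continuous (fun x => Im (phi x))}.
Proof. by move=> h x /h hx; apply: (continuous_comp hx); exact: continuous_Im. Qed.

Lemma in_within (a b : R) (f : R -> R) :
  {in `[a, b], continuous f} -> {within `[a, b], continuous f}.
Proof. by move=> cf; apply: continuous_in_subspaceT => x /set_mem/= /cf. Qed.

Lemma in_cont_integrable (a b : R) (f : R -> R) :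
  {in `[a, b], continuous f} -> mu.-integrable `[a, b] (EFin \o f).
Proof.
move=> /in_within cf; apply: continuous_compact_integrable => //.
exact: segment_compact.
Qed.

Lemma in_contD a b f g : in_cont a b f -> in_cont a b g -> in_cont a b (fun x => f x + g x).
Proof. by move=> cf cg x xab; apply: (@continuousD _ C _ f g); [exact: cf|exact: cg]. Qed.

Lemma in_contM a b f g : in_cont a b f -> in_cont a b g -> in_cont a b (fun x => f x * g x).
Proof. by move=> cf cg x xab; apply: (@continuousM R[i] _ f g); [exact: cf|exact: cg]. Qed.

Lemma in_contZ a b c f : in_cont a b f -> in_cont a b (fun x => c * f x).
Proof.
by move=> cf x xab; apply: (@continuousM R[i] _ (fun=> c) f); [exact: cst_continuous|exact: cf].
Qed.

Lemma in_cont_cst a b c : in_cont a b (fun=> c).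
Proof. by move=> x _; exact: cst_continuous. Qed.

Lemma in_contN a b f : in_cont a b f -> in_cont a b (fun x => - f x).
Proof. by move=> cf x xab; apply: (@continuousN _ C _ f); exact: cf. Qed.

Lemma in_contB a b f g : in_cont a b f -> in_cont a b g -> in_cont a b (fun x => f x - g x).
Proof. by move=> cf cg; exact: (in_contD cf (in_contN cg)). Qed.

Lemma cintD a b f g : in_cont a b f -> in_cont a b g ->
  cint a b (fun x => f x + g x) = cint a b f + cint a b g.
Proof.
move=> cf cg; apply: complex_eq; rewrite raddfD/= -RintegralD//;
  try (by apply: in_cont_integrable; (exact: in_cont_Re || exact: in_cont_Im));
  by apply: eq_Rintegral => x _; rewrite raddfD.
Qed.

Lemma Re_mulc (z w : R[i]) : Re (z * w) = Re z * Re w - Im z * Im w.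
Proof. by case: z w => a b []. Qed.

Lemma Im_mulc (z w : R[i]) : Im (z * w) = Re z * Im w + Im z * Re w.
Proof. by case: z w => a b []. Qed.

Lemma cintZ a b c f : in_cont a b f -> cint a b (fun x => c * f x) = c * cint a b f.
Proof.
move=> cf.
have ir := in_cont_integrable (in_cont_Re cf).
have ii := in_cont_integrable (in_cont_Im cf).
have iZ (k : R) (h : R -> R) : mu.-integrable `[a, b] (EFin \o h) ->
    mu.-integrable `[a, b] (EFin \o (fun x => k * h x)).
  move=> ih; rewrite (_ : _ \o _ = (fun x => k%:E * (EFin \o h) x)%E)//.
  exact: integrableZl.
apply: complex_eq; rewrite ?Re_mulc ?Im_mulc !Re_cint !Im_cint.
  rewrite -!RintegralZl// -RintegralB//; [|exact: iZ|exact: iZ].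
  by apply: eq_Rintegral => x _; rewrite Re_mulc.
rewrite -!RintegralZl// -RintegralD//; [|exact: iZ|exact: iZ].
by apply: eq_Rintegral => x _; rewrite Im_mulc.
Qed.

Lemma cintN a b f : in_cont a b f -> cint a b (fun x => - f x) = - cint a b f.
Proof.
move=> cf; rewrite -mulN1r -cintZ//; apply: eq_cint => x _; by rewrite mulN1r.
Qed.

Lemma cintB a b f g : in_cont a b f -> in_cont a b g ->
  cint a b (fun x => f x - g x) = cint a b f - cint a b g.
Proof. by move=> cf cg; rewrite (cintD cf (in_contN cg)) (cintN cg). Qed.

Lemma ler_Rint (a b M : R) (f : R -> R) : a <= b -> {in `[a, b], continuous f} ->
  {in `[a, b], forall x, `|f x| <= M} -> `|\int[mu]_(x in `[a, b]) f x| <= M * (b - a).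
Proof.
move=> ab cf fM; have fi := in_cont_integrable cf.
apply: (le_trans (le_normr_Rintegral _ fi)) => //.
apply: (@le_trans _ _ (\int[mu]_(x in `[a, b]) M)).
  apply: le_Rintegral => //.
    exact: integrable_norm.
  by apply: in_cont_integrable => x _; exact: cst_continuous.
rewrite (Rintegral_cst mu (measurable_itv _))/= lebesgue_measure_itv/= lte_fin.
by move: ab; rewrite le_eqVlt => /predU1P[->|->]; rewrite ?ltxx//= subrr.
Qed.

(* The factor 2 comes from bounding real and imaginary parts separately. *)
Lemma normc_cint_le (a b M : R) f : a <= b -> in_cont a b f ->
  {in `[a, b], forall x, normc (f x) <= M} -> normc (cint a b f) <= 2 * M * (b - a).
Proof.
move=> ab cf fM; apply: (le_trans (ler_normc_ReIm _)).
rewrite mulrDl mul1r mulrDl.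
apply: lerD; apply: ler_Rint => //;
  do ?[exact: in_cont_Re|exact: in_cont_Im]; move=> x /fM; apply: le_trans;
  [exact: ler_Re_normc|exact: ler_Im_normc].
Qed.

(** [C] is a normed space over [R[i]], so a derivative in a real variable is taken componentwise. *)
Definition rder (phi : R -> C) (x : R) (d : C) :=
  is_derive x 1 (fun t => Re (phi t)) (Re d) /\
  is_derive x 1 (fun t => Im (phi t)) (Im d).

Lemma Rint_FTC (a b : R) (f F : R -> R) : a < b -> {within `[a, b], continuous f} ->
  {in `[a, b], forall x : R, is_derive x 1 F (f x)} ->
  \int[mu]_(x in `[a, b]) f x = F b - F a.
Proof.
move=> ab cf dF.
have cF x : x \in `[a, b] -> {for x, continuous F}.
  by move=> /dF h; apply: differentiable_continuous; apply/derivable1_diffP.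
rewrite /Rintegral (continuous_FTC2 ab cf (F := F))//.
  split.
  - by move=> x xab; have [//] := dF x (subset_itv_oo_cc xab).
  - by apply: cvg_at_right_filter; apply: cF; rewrite bound_itvE ltW.
  - by apply: cvg_at_left_filter; apply: cF; rewrite bound_itvE ltW.
move=> x xab; rewrite derive1E.
by have h := dF x (subset_itv_oo_cc xab); rewrite derive_val.
Qed.

Lemma cint_FTC (a b : R) (f F : R -> C) : a < b -> in_cont a b f ->
  {in `[a, b], forall x : R, rder F x (f x)} -> cint a b f = F b - F a.
Proof.
move=> ab cf dF; apply: complex_eq; rewrite raddfB/=.
  rewrite (Rint_FTC (F := fun t => Re (F t)) ab (in_within (in_cont_Re cf)))// => x xab.
  by have [] := dF x xab.
rewrite (Rint_FTC (F := fun t => Im (F t)) ab (in_within (in_cont_Im cf)))// => x xab.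
by have [] := dF x xab.
Qed.

(** Convergence that is joint in the point and the parameter is uniform on the compact interval, by
    a covering argument. *)
Lemma cint_cvg (T : Type) (F : set_system T) (FF : Filter F) (a b : R)
    (k : T -> R -> C) (k0 : R -> C) :
  a <= b -> (\forall p \near F, in_cont a b (k p)) -> in_cont a b k0 ->
  (forall x, x \in `[a, b] -> (fun q : R * T => k q.2 q.1 - k0 q.1 : C) @ (nbhs x, F) --> (0 : C)) ->
  (fun p => cint a b (k p)) @ F --> cint a b k0.
Proof.
move=> ab ck ck0 kk0; apply/cvgcP => e e0.
(* The 2 is the constant of [normc_cint_le]; adding 1 keeps the denominator positive when a = b. *)
pose d := e / (2 * (b - a) + 1).
have ba1 : 0 < 2 * (b - a) + 1 by rewrite ltr_wpDl// mulr_ge0// subr_ge0.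
have d0 : 0 < d by rewrite divr_gt0.
have cpt : compact `[a, b] by exact: segment_compact.
have near_d : \forall p \near F, `[a, b] `<=` (fun x => normc (k p x - k0 x) < d).
  move/compact_near_coveringP : cpt; apply => x /= xab.
  have /cvgcP/(_ d d0) := kk0 x xab.
  by apply: filterS => -[y p]/=; rewrite sub0r normcNE.
near=> p.
have ckp : in_cont a b (k p) by near: p.
rewrite -(cintB ck0 ckp).
apply: (@le_lt_trans _ _ (2 * d * (b - a))).
  apply: (normc_cint_le ab (in_contB ck0 ckp)).
  move=> x xab; apply: ltW; rewrite normc_distC.
  by move: x xab; near: p.
have : d * (2 * (b - a) + 1) = e by rewrite divfK ?gt_eqF.
lra.
Unshelve. all: by end_near. Qed.

End IntervalIntegral.

(** * Derivatives and primitives *)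

(** Free of quotients, this form also covers h = 0; the general field lets it serve real and complex
    derivatives alike. *)
Lemma is_derive_littleoP (K : numFieldType) (g : K^o -> K^o) (z d : K^o) :
  is_derive z 1 g d <->
  forall e : K, 0 < e -> \forall h \near (0 : K^o), `|g (z + h) - g z - d * h| <= e * `|h|.
Proof.
have E (h : K) : h != 0 ->
    `|d - h^-1 *: (g (h *: (1 : K^o) + z) - g z)| * `|h| = `|g (z + h) - g z - d * h|.
  move=> h0; rewrite -normrM mulrBl [_ *: 1]mulr1 (addrC h) /GRing.scale/= -[h^-1 * _ * h]mulrAC.
  by rewrite mulVf// mul1r -normrN opprB.
split=> [dg e e0|H].
  have : h^-1 *: (g (h *: (1 : K^o) + z) - g z) @[h --> 0^'] --> d.
    have [dgz <-] := dg; exact: dgz.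
  move/cvgrPdist_le/(_ e e0); rewrite near_withinE.
  apply: filterS => h hh; have [->|h0] := eqVneq h 0.
    by rewrite addr0 subrr mulr0 subrr !normr0 mulr0.
  by rewrite -E// ler_wpM2r// hh.
have cv : h^-1 *: (g (h *: (1 : K^o) + z) - g z) @[h --> 0^'] --> d.
  apply/cvgrPdist_le => e e0; rewrite near_withinE.
  have := H _ e0; apply: filterS => h hh h0.
  by rewrite -(ler_pM2r (x := `|h|)) ?normr_gt0// E.
by apply: DeriveDef; [apply/cvg_ex; exists d|apply: cvg_lim].
Qed.

Section ComplexDerivative.
Context {R : realType}.
Local Notation C := (R[i]^o).

Lemma cderP (f : C -> C) (z d : C) :
  is_derive z 1 f d <->
  forall e : R, 0 < e -> \forall h \near (0 : C), normc (f (z + h) - f z - d * h) <= e * normc h.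
Proof.
split=> [/is_derive_littleoP df e e0|H].
  have /df : 0 < e%:C by rewrite ltcR.
  apply: filterS => h; rewrite !normrE_normc -rmorphM/= lecR.
  exact.
apply/is_derive_littleoP => e; rewrite ltcE => /andP[/eqP/= e1 e0].
have -> : e = (Re e)%:C by case: e e1 {e0} => a b /= ->.
have := H _ e0; apply: filterS => h.
by rewrite !normrE_normc -rmorphM/= lecR.
Qed.

Lemma rderP (f : R -> C) (x : R) (d : C) :
  rder f x d <->
  forall e : R, 0 < e -> \forall h \near (0 : R), normc (f (x + h) - f x - d * h%:C) <= e * `|h|.
Proof.
have ReE (w : C) (h : R) : Re (w * h%:C) = Re w * h by rewrite Re_mulc/= mulr0 subr0.
have ImE (w : C) (h : R) : Im (w * h%:C) = Im w * h by rewrite Im_mulc/= mulr0 add0r.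
split=> [[d1 d2] e e0|H].
  have e20 : 0 < e / 2 by rewrite divr_gt0.
  move/is_derive_littleoP : d1 => /(_ _ e20) d1.
  move/is_derive_littleoP : d2 => /(_ _ e20) d2.
  near=> h.
  apply: (le_trans (ler_normc_ReIm _)).
  rewrite (splitr e) mulrDl; apply: lerD; rewrite !raddfB/= ?ReE ?ImE; near: h; [exact: d1|exact: d2].
split; apply/is_derive_littleoP => e e0; have := H _ e0; apply: filterS => h; apply: le_trans.
  by rewrite -ReE -!raddfB/= ler_Re_normc.
by rewrite -ImE -!raddfB/= ler_Im_normc.
Unshelve. all: by end_near. Qed.

Lemma rder_cont (f : R -> C) (x : R) (d : C) : rder f x d -> {for x, continuous f}.
Proof.
move=> [d1 d2]; apply: cvgc_ReIm.
  by apply: differentiable_continuous; apply/derivable1_diffP.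
by apply: differentiable_continuous; apply/derivable1_diffP.
Qed.

Lemma cder_cont (f : C -> C) (z d : C) : is_derive z 1 f d -> {for z, continuous f}.
Proof. by move=> df; apply: differentiable_continuous; apply/derivable1_diffP. Qed.

Lemma near_normc0 (T : topologicalType) (f : T -> C) (t : T) (e : R) :
  0 < e -> {for t, continuous f} -> \forall s \near t, normc (f s - f t) < e.
Proof.
move=> e0 /cvgcP/(_ e e0); apply: filterS => s; by rewrite normc_distC.
Qed.

(** The inner function is differentiated over [R] and the outer one over [R[i]], hence a direct
    estimate with little-o remainders. *)
Lemma rder_comp (f : C -> C) (phi : R -> C) (x : R) (d1 d2 : C) :
  rder phi x d1 -> is_derive (phi x) 1 f d2 -> rder (f \o phi) x (d2 * d1).
Proof.
move=> dphi df; apply/rderP => e e0.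
(* Half of [e] is left for the remainder of [f], whose increment is at most (|d1| + 1) |h|. *)
pose e1 := e / (2 * (normc d1 + 1)).
have c10 : 0 < normc d1 + 1 by rewrite ltr_wpDl// normc_ge0.
have c20 : 0 < normc d2 + 1 by rewrite ltr_wpDl// normc_ge0.
have e10 : 0 < e1 by rewrite divr_gt0// mulr_gt0.
(* The bound 1 gives that Lipschitz estimate ([k3]); the other one makes |d2| times the remainder of
   [phi] at most (e / 2) |h|. *)
pose e2 := Num.min 1 (e / (2 * (normc d2 + 1))).
have e20 : 0 < e2 by rewrite lt_min ltr01/= divr_gt0// mulr_gt0.
have cphi : (fun h => phi (x + h) - phi x) @ (0 : R) --> (0 : C).
  rewrite -[X in _ --> X](subrr (phi x)); apply: cvgB; last exact: cvg_cst.
  have c : x + h @[h --> (0 : R)] --> x.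
    by rewrite -[X in _ --> X]addr0; apply: cvgD; [exact: cvg_cst|exact: cvg_id].
  exact: (cvg_comp _ _ c (rder_cont dphi)).
have /cderP/(_ _ e10) h1 := df.
have /rderP/(_ _ e20) h2 := dphi.
have {}h1 := cphi _ h1.
near=> h.
have k1 : normc (f (phi x + (phi (x + h) - phi x)) - f (phi x) - d2 * (phi (x + h) - phi x))
   <= e1 * normc (phi (x + h) - phi x) by near: h.
have k2 : normc (phi (x + h) - phi x - d1 * h%:C) <= e2 * `|h| by near: h.
rewrite (addrC (phi x)) subrK in k1.
have k3 : normc (phi (x + h) - phi x) <= (normc d1 + 1) * `|h|.
  rewrite -(subrK (d1 * h%:C) (phi (x + h) - phi x)).
  apply: (le_trans (ler_normcD _ _)); rewrite normcM normc_real mulrDl addrC lerD2l.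
  apply: (le_trans k2); apply: ler_wpM2r => //; by rewrite /e2 ge_min lexx.
rewrite /=.
set D := phi (x + h) - phi x in k1 k2 k3.
have -> : f (phi (x + h)) - f (phi x) - d2 * d1 * h%:C =
  (f (phi (x + h)) - f (phi x) - d2 * D) + d2 * (D - d1 * h%:C) by ring.
apply: (le_trans (ler_normcD _ _)); rewrite normcM (splitr e) mulrDl; apply: lerD.
  apply: (le_trans k1); apply: (le_trans (ler_wpM2l (ltW e10) k3)).
  have -> : e / 2 = e1 * (normc d1 + 1) by rewrite /e1; field; rewrite gt_eqF.
  by rewrite mulrA.
apply: (le_trans (ler_wpM2l (normc_ge0 _) k2)); rewrite mulrA ler_wpM2r//.
apply: (@le_trans _ _ ((normc d2 + 1) * (e / (2 * (normc d2 + 1))))).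
  apply: ler_pM; rewrite ?normc_ge0 ?(ltW e20) ?lerDl// /e2 ge_min lexx orbT//.
have -> : (normc d2 + 1) * (e / (2 * (normc d2 + 1))) = e / 2; last by [].
by field; rewrite gt_eqF.
Unshelve. all: by end_near. Qed.

End ComplexDerivative.

(** * Primitives in a real variable and affine substitutions *)

Section Primitive.
Context {R : realType}.
Local Notation C := (R[i]^o).
Local Notation mu := (@lebesgue_measure R).

(** To have two-sided derivatives at [a] and [b], [f] is extended by constants beyond the interval
    ([k] clamps to [a, b]) and integrated from a - 1, so that every point of [a, b] is interior. *)
Lemma within_primitive (a b : R) (f : R -> R) : a < b -> {within `[a, b], continuous f} ->
  exists F : R -> R, forall x : R, x \in `[a, b] -> is_derive x 1 F (f x).
Proof.
move=> ab /subspace_continuousP cf.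
pose k x := Num.max a (Num.min b x).
have kab x : k x \in `[a, b].
  by rewrite in_itv/= /k le_max lexx/= ge_max (ltW ab) ge_min lexx.
have kE x : x \in `[a, b] -> k x = x.
  by rewrite in_itv/= => /andP[ax xb]; rewrite /k (min_idPr xb) (max_idPr ax).
have ck : continuous k.
  by move=> x; apply: continuous_max; [exact: cst_continuous|apply: continuous_min => //; exact: cst_continuous].
pose g := f \o k.
have cg : continuous g.
  move=> x; have := cf (k x) (kab x) => cfx.
  apply: (@cvg_trans _ (f @ within `[a, b] (nbhs (k x)))); last exact: cfx.
  move=> A /= h.
  have hx : \forall y \near x, `[a, b]%classic (k y) -> A (f (k y)) := ck x _ h.
  suff : \forall y \near x, A (g y) by [].
  by apply: filterS hx => y; apply; exact: kab.
exists (fun x => \int[mu]_(t in `[a - 1, x]) g t) => x xab.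
have ax : a - 1 < x by move: xab; rewrite in_itv/= => /andP[ax _]; lra.
have xx1 : x < x + 1 by rewrite ltrDl.
have ig : mu.-integrable `[a - 1, x + 1] (EFin \o g).
  by apply: in_cont_integrable => y _; exact: cg.
have [d1 d2] := continuous_FTC1_closed xx1 ig ax (cg x).
rewrite (_ : f x = g x); last by rewrite /g/= kE.
by apply: DeriveDef; [exact: d1|rewrite -derive1E].
Qed.

Lemma in_cont_primitive (a b : R) (f : R -> C) : a < b -> in_cont a b f ->
  exists F : R -> C, forall x : R, x \in `[a, b] -> rder F x (f x).
Proof.
move=> ab cf.
have [F1 d1] := within_primitive ab (in_within (in_cont_Re cf)).
have [F2 d2] := within_primitive ab (in_within (in_cont_Im cf)).
by exists (fun x => F1 x +i* F2 x) => x xab; split => /=; [exact: d1|exact: d2].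
Qed.

Lemma rder_real (g : R -> R) (x d : R) : is_derive x 1 g d ->
  rder (fun t => (g t)%:C) x d%:C.
Proof. by move=> dg; split => //=; exact: is_derive_cst. Qed.

Lemma rder_comp_real (F : R -> C) (g : R -> R) (x d : R) (e : C) :
  is_derive x 1 g d -> rder F (g x) e -> rder (fun t => F (g t)) x (e * d%:C).
Proof.
move=> dg [h1 h2]; split.
  rewrite Re_mulc /= mulr0 subr0.
  exact: (@is_derive1_comp _ (fun t => Re (F t)) g x _ _ h1 dg).
rewrite Im_mulc /= mulr0 add0r.
exact: (@is_derive1_comp _ (fun t => Im (F t)) g x _ _ h2 dg).
Qed.

Lemma rder_eq (F : R -> C) (x : R) (d e : C) : rder F x d -> d = e -> rder F x e.
Proof. by move=> h <-. Qed.

Lemma rderM (F G : R -> C) (x : R) (d e : C) : rder F x d -> rder G x e ->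
  rder (fun t => F t * G t) x (d * G x + F x * e).
Proof.
move=> [f1 f2] [g1 g2]; split.
  have -> : (fun t => Re (F t * G t)) =
      (fun t => Re (F t)) * (fun t => Re (G t)) - (fun t => Im (F t)) * (fun t => Im (G t)).
    by apply/funext => t; exact: Re_mulc.
  have -> : Re (d * G x + F x * e) =
      Re d * Re (G x) - Im d * Im (G x) + (Re (F x) * Re e - Im (F x) * Im e).
    by case: d (G x) (F x) e {f1 f2 g1 g2} => [? ?] [? ?] [? ?] [? ?].
  by apply: is_derive_eq; rewrite /GRing.scale/=; ring.
have -> : (fun t => Im (F t * G t)) =
    (fun t => Re (F t)) * (fun t => Im (G t)) + (fun t => Im (F t)) * (fun t => Re (G t)).
  by apply/funext => t; exact: Im_mulc.
have -> : Im (d * G x + F x * e) =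
    Re d * Im (G x) + Im d * Re (G x) + (Re (F x) * Im e + Im (F x) * Re e).
  by case: d (G x) (F x) e {f1 f2 g1 g2} => [? ?] [? ?] [? ?] [? ?].
apply: (is_derive_eq (is_deriveD (is_deriveM f1 g2) (is_deriveM f2 g1))).
by rewrite /GRing.scale/=; ring.
Qed.

Lemma rderD (F G : R -> C) (x : R) (d e : C) : rder F x d -> rder G x e ->
  rder (fun t => F t + G t) x (d + e).
Proof.
move=> [f1 f2] [g1 g2]; split; rewrite raddfD.
  have -> : (fun t => Re (F t + G t)) = (fun t => Re (F t)) + (fun t => Re (G t)).
    by apply/funext => t; rewrite raddfD.
  exact: is_deriveD.
have -> : (fun t => Im (F t + G t)) = (fun t => Im (F t)) + (fun t => Im (G t)).
  by apply/funext => t; rewrite raddfD.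
exact: is_deriveD.
Qed.

Lemma rder_cst (c : C) (x : R) : rder (fun=> c) x 0.
Proof. by split; exact: is_derive_cst. Qed.

(** Substitution through a primitive [F]; it is applied with d = -1 (reversal) and d = 1/2
    (bisection). *)
Lemma cint_affine (f : R -> C) (c d : R) :
  in_cont 0 1 f -> (forall t, t \in `[0, 1] -> c + t * d \in `[0, 1]) ->
  forall F : R -> C, (forall x : R, x \in `[0, 1] -> rder F x (f x)) ->
  cint 0 1 (fun t => f (c + t * d) * d%:C) = F (c + d) - F c.
Proof.
move=> cf cd F dF.
have dl (t : R) : is_derive t 1 (fun t => c + t * d) d.
  have h := is_deriveD (is_derive_cst c t 1) (is_deriveM (is_derive_id t 1) (is_derive_cst d t 1)).
  by apply: (is_derive_eq h); rewrite add0r /GRing.scale/= mulr0 mulr1 add0r.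
have c1 : in_cont 0 1 (fun t => f (c + t * d)).
  move=> t t01.
  have ct : {for t, continuous (fun t : R => c + t * d)}.
    by apply: differentiable_continuous; apply/derivable1_diffP.
  exact: (@continuous_comp _ _ _ (fun t : R => c + t * d) f t ct (cf _ (cd _ t01))).
have dF1 : {in `[0, 1], forall t : R, rder (fun t => F (c + t * d)) t (f (c + t * d) * d%:C)}.
  by move=> t t01; apply: rder_comp_real; exact/dF/cd.
have := cint_FTC ltr01 (in_contM c1 (@in_cont_cst _ 0 1 d%:C)) dF1.
by rewrite mul1r mul0r addr0.
Qed.

Lemma cint01_rev (f : R -> C) : in_cont 0 1 f ->
  cint 0 1 (fun t => f (1 - t)) = cint 0 1 f.
Proof.
move=> cf; have [F dF] := in_cont_primitive (ltr01) cf.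
have h t : t \in `[0, 1] -> 1 + t * (-1 : R) \in `[0, 1] by rewrite !in_itv/=; lra.
rewrite (cint_FTC ltr01 cf dF).
have := cint_affine cf h dF; rewrite subrr.
have -> : (fun t => f (1 + t * -1) * (-1)%:C) = (fun t => - f (1 - t)).
  by apply/funext => t; rewrite mulrN1 rmorphN rmorph1 mulrN1.
rewrite cintN; last first.
  move=> t t01.
  have ct : {for t, continuous (fun t : R => 1 - t)}.
    by apply: continuousB; [exact: cst_continuous|exact: cvg_id].
  apply: (@continuous_comp _ _ _ (fun t : R => 1 - t) f t ct).
  by apply: cf; rewrite -[- t]mulrN1 h.
by move=> /(congr1 -%R); rewrite opprK opprB.
Qed.

Lemma cint01_half (f : R -> C) : in_cont 0 1 f ->
  cint 0 1 (fun t => f (t / 2) * (2^-1)%:C) + cint 0 1 (fun t => f ((1 + t) / 2) * (2^-1)%:C)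
   = cint 0 1 f.
Proof.
move=> cf; have [F dF] := in_cont_primitive (ltr01) cf.
have h1 t : t \in `[0, 1] -> 0 + t * (2^-1 : R) \in `[0, 1] by rewrite !in_itv/=; lra.
have h2 t : t \in `[0, 1] -> 2^-1 + t * (2^-1 : R) \in `[0, 1] by rewrite !in_itv/=; lra.
rewrite (cint_FTC ltr01 cf dF).
have <- : (fun t => f (0 + t * 2^-1) * (2^-1)%:C) = (fun t => f (t / 2) * (2^-1)%:C).
  by apply/funext => t; rewrite add0r.
have <- : (fun t => f (2^-1 + t * 2^-1) * (2^-1)%:C) = (fun t => f ((1 + t) / 2) * (2^-1)%:C).
  by apply/funext => t; rewrite mulrDl mul1r.
rewrite (cint_affine cf h1 dF) (cint_affine cf h2 dF) add0r.
have -> : 2^-1 + 2^-1 = 1 :> R by field.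
by rewrite addrC subrKA.
Qed.

End Primitive.

(** * Integrals along segments and triangles *)

Section Segment.
Context {R : realType}.
Local Notation C := (R[i]^o).

Definition segint (f : C -> C) (a b : C) : C :=
  cint 0 1 (fun t : R => f (a + t%:C * (b - a)) * (b - a)).

Lemma segment_cont (a b : C) (t : R) : {for t, continuous (fun t : R => a + t%:C * (b - a) : C)}.
Proof.
apply: (@continuousD _ C _ (fun=> a) (fun t : R => t%:C * (b - a))); first exact: cst_continuous.
apply: (@continuousM R[i] _ (fun t : R => t%:C : C) (fun=> b - a : C)); last exact: cst_continuous.
exact: continuous_real_complex.
Qed.

Lemma segment_rder (a b : C) (t : R) : rder (fun t : R => a + t%:C * (b - a) : C) t (b - a).
Proof.
apply: (rder_eq (rderD (rder_cst a t) (rderM (rder_real (is_derive_id t 1)) (rder_cst (b - a) t)))).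
by rewrite /= add0r mulr0 addr0 mul1r.
Qed.

Definition fcont (r : R) (f : C -> C) := forall z : C, normc z < r -> {for z, continuous f}.

Lemma segment_disc (r t : R) (a b : C) : t \in `[0, 1] ->
  normc a < r -> normc b < r -> normc (a + t%:C * (b - a)) < r.
Proof.
rewrite in_itv/= => /andP[t0 t1] ar br.
have -> : a + t%:C * (b - a) = (1 - t)%:C * a + t%:C * b :> R[i].
  by rewrite rmorphB rmorph1; ring.
apply: (le_lt_trans (ler_normcD _ _)); rewrite !normcM !normc_real.
rewrite (ger0_norm t0) ger0_norm ?subr_ge0//.
have -> : r = (1 - t) * r + t * r by ring.
(* The strict inequality comes from the term with [b], whose weight is 0 when t = 0. *)
have [->|tn0] := eqVneq t 0; first by rewrite !mul0r !addr0 subr0 !mul1r.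
apply: ler_ltD; first by apply: ler_wpM2l; rewrite ?subr_ge0 ?(ltW ar).
by rewrite ltr_pM2l// lt_neqAle eq_sym tn0.
Qed.

Lemma segint_cont r f a b : fcont r f -> normc a < r -> normc b < r ->
  in_cont 0 1 (fun t : R => f (a + t%:C * (b - a)) * (b - a)).
Proof.
move=> cf ar br.
have c1 : in_cont 0 1 (fun t : R => f (a + t%:C * (b - a))).
  move=> t t01; have ct := @segment_cont a b t.
  exact: (@continuous_comp _ _ _ (fun t : R => a + t%:C * (b - a) : C) f t ct (cf _ (segment_disc t01 ar br))).
exact: (in_contM c1 (@in_cont_cst _ 0 1 (b - a))).
Qed.

Lemma segintE r (f F : C -> C) a b : fcont r f ->
  (forall z : C, normc z < r -> is_derive z 1 F (f z)) ->
  normc a < r -> normc b < r -> segint f a b = F b - F a.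
Proof.
move=> cf dF ar br.
have d : {in `[0, 1], forall t : R, rder (fun t : R => F (a + t%:C * (b - a)))
    t (f (a + t%:C * (b - a)) * (b - a))}.
  move=> t t01; apply: (@rder_comp _ F (fun t : R => a + t%:C * (b - a))).
    exact: segment_rder.
  by apply: dF; exact: segment_disc.
have := cint_FTC ltr01 (segint_cont cf ar br) d.
by rewrite mul1r mul0r addr0 (addrC a) subrK.
Qed.

Lemma segint_rev r f a b : fcont r f -> normc a < r -> normc b < r ->
  segint f b a = - segint f a b.
Proof.
move=> cf ar br.
rewrite /segint -(cint01_rev (segint_cont cf br ar)) -(cintN (segint_cont cf ar br)).
apply: eq_cint => t _.
have -> : b + (1 - t)%:C * (a - b) = a + t%:C * (b - a) :> R[i].
  by rewrite rmorphB rmorph1; ring.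
by rewrite -mulrN opprB.
Qed.

Lemma segint_mid r f a b : fcont r f -> normc a < r -> normc b < r ->
  segint f a b = segint f a ((a + b) / 2) + segint f ((a + b) / 2) b.
Proof.
move=> cf ar br.
rewrite {1}/segint -(cint01_half (segint_cont cf ar br)).
have hC : (2^-1)%:C = 2^-1 :> R[i] by rewrite fmorphV rmorph_nat.
congr (_ + _); apply: eq_cint => t _; rewrite -mulrA.
  congr (f _ * _).
    by rewrite rmorphM/= hC; field.
  by rewrite hC; field.
congr (f _ * _).
  by rewrite rmorphM/= hC rmorphD rmorph1; field.
by rewrite hC; field.
Qed.

Lemma segintB r f g a b : fcont r f -> fcont r g -> normc a < r -> normc b < r ->
  segint (fun z => f z - g z) a b = segint f a b - segint g a b.
Proof.
move=> cf cg ar br.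
rewrite /segint -(cintB (segint_cont cf ar br) (segint_cont cg ar br)).
by apply: eq_cint => t _; rewrite mulrBl.
Qed.

Lemma normc_segint_le r f a b M : fcont r f -> normc a < r -> normc b < r ->
  (forall t : R, t \in `[0, 1] -> normc (f (a + t%:C * (b - a))) <= M) ->
  normc (segint f a b) <= 2 * M * normc (b - a).
Proof.
move=> cf ar br fM.
rewrite -mulrA -[leRHS]mulr1 -[X in _ <= _ * X](subr0 1).
apply: (normc_cint_le ler01 (segint_cont cf ar br)) => t t01.
by rewrite normcM; apply: ler_wpM2r; [exact: normc_ge0|exact: fM].
Qed.

Definition triint f a b c : C := segint f a b + segint f b c + segint f c a.

Lemma mid_disc (r : R) (a b : C) : normc a < r -> normc b < r -> normc ((a + b) / 2) < r.
Proof.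
move=> ar br.
have -> : (a + b) / 2 = a + (2^-1 : R)%:C * (b - a) :> R[i].
  by rewrite fmorphV rmorph_nat; field.
by apply: segment_disc => //; rewrite in_itv/=; lra.
Qed.

(** Each side of the medial triangle is traversed twice, in opposite directions, and cancels. *)
Lemma triint_mid r f a b c : fcont r f -> normc a < r -> normc b < r -> normc c < r ->
  let p := (a + b) / 2 in let q := (b + c) / 2 in let s := (c + a) / 2 in
  triint f a b c =
  triint f a p s + triint f p b q + triint f s q c + triint f p q s.
Proof.
move=> cf ar br cr p q s.
have pr : normc p < r by exact: mid_disc.
have qr : normc q < r by exact: mid_disc.
have sr : normc s < r by exact: mid_disc.
rewrite /triint (segint_mid cf ar br) (segint_mid cf br cr) (segint_mid cf cr ar) -/p -/q -/s.
rewrite (segint_rev cf pr qr) (segint_rev cf qr sr) (segint_rev cf sr pr).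
by ring.
Qed.

End Segment.

(** * Goursat's theorem *)

Section Goursat.
Context {R : realType}.
Local Notation C := (R[i]^o).

(** Nested intervals: the radius 2 d 2^-n drops by exactly d 2^-n from one index to the next, which
    absorbs the step of [x]; the limit is the supremum of the left end points. *)
Lemma geometric_limit (x : nat -> R) (d : R) :
  (forall n, `|x n.+1 - x n| <= d * 2^-1 ^+ n) ->
  exists p, forall n, `|x n - p| <= 2 * d * 2^-1 ^+ n.
Proof.
move=> hx.
have e0 n : 0 <= d * 2^-1 ^+ n by exact: le_trans (hx n).
pose l n := x n - 2 * (d * 2^-1 ^+ n).
pose u n := x n + 2 * (d * 2^-1 ^+ n).
have E n : 2 * (d * 2^-1 ^+ n.+1) = d * 2^-1 ^+ n by rewrite exprS; field.
have lS n : l n <= l n.+1.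
  by rewrite /l E; have := hx n; rewrite ler_norml => /andP[]; lra.
have uS n : u n.+1 <= u n.
  by rewrite /u E; have := hx n; rewrite ler_norml => /andP[]; lra.
have lm : {homo l : n m / (n <= m)%N >-> n <= m} by exact/nondecreasing_seqP.
have um : {homo u : n m / (n <= m)%N >-> n >= m}.
  by apply/nonincreasing_seqP.
have lu n m : l n <= u m.
  apply: (le_trans (lm _ _ (leq_maxl n m))); apply: le_trans (um _ _ (leq_maxr n m)).
  by rewrite /l /u; have := e0 (maxn n m); lra.
have hs : has_sup (range l).
  by split; [exists (l 0%N), 0%N|exists (u 0%N) => _ [n _ <-]].
exists (sup (range l)) => n.
have h1 : l n <= sup (range l) by apply: ub_le_sup; [case: hs|exists n].
have h2 : sup (range l) <= u n by apply: ge_sup => [|_ [m _ <-]//]; case: hs.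
by rewrite -mulrA ler_norml; apply/andP; split; move: h1 h2; rewrite /l /u; lra.
Qed.

(* A tuple [(a, b, c, d)] is a triangle together with a bound [d] on its sides. *)
Definition tri_inv (r : R) (T : C * C * C * R) : Prop :=
  let: (a, b, c, d) := T in
  [/\ normc a < r, normc b < r & normc c < r] /\
  [/\ normc (b - a) <= d, normc (c - b) <= d & normc (a - c) <= d].

Definition tri_val (f : C -> C) (T : C * C * C * R) : R :=
  let: (a, b, c, d) := T in normc (triint f a b c).

(** Of the four triangles cut out by the midpoints, at least one carries a quarter of the modulus of
    the integral. *)
Lemma tri_step r f T : fcont r f -> tri_inv r T ->
  exists T' : C * C * C * R, [/\ tri_inv r T', T'.2 = T.2 / 2,
    normc (T'.1.1.1 - T.1.1.1) <= T.2 & tri_val f T <= 4 * tri_val f T'].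
Proof.
case: T => [[[a b] c] d] cf [[ar br cr] [ab bc ca]].
pose p := (a + b) / 2; pose q := (b + c) / 2; pose s := (c + a) / 2.
have pr : normc p < r by exact: mid_disc.
have qr : normc q < r by exact: mid_disc.
have sr : normc s < r by exact: mid_disc.
have d0 : 0 <= d by exact: le_trans (normc_ge0 _) ab.
have n2 : normc (2^-1 : R[i]) = 2^-1.
  have -> : 2^-1 = (2^-1 : R)%:C :> R[i] by rewrite fmorphV rmorph_nat.
  by rewrite normc_real ger0_norm ?invr_ge0.
have half (z w : R[i]) : normc z <= d -> w = z / 2 -> normc w <= d / 2.
  by move=> zd ->; rewrite normcM n2 ler_pM2r.
have ba : normc (a - b) <= d by rewrite normc_distC.
have cb : normc (b - c) <= d by rewrite normc_distC.
have ac : normc (c - a) <= d by rewrite normc_distC.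
have dd : d / 2 <= d by lra.
pose Ts := [:: (a, p, s, d / 2); (p, b, q, d / 2); (s, q, c, d / 2); (p, q, s, d / 2)].
have inv T : T \in Ts -> [/\ tri_inv r T, T.2 = d / 2 & normc (T.1.1.1 - a) <= d].
  have pa : normc (p - a) <= d by apply: le_trans dd; apply: (half _ _ ab); rewrite /p; field.
  have sa : normc (s - a) <= d by apply: le_trans dd; apply: (half _ _ ac); rewrite /s; field.
  rewrite !inE => /or4P[] /eqP->; split => //=; try (by rewrite subrr (eqP (_ : normc 0 == 0)) ?normc_eq0).
  - split; [by split|split].
    + by apply: (half _ _ ab); rewrite /p; field.
    + by apply: (half _ _ bc); rewrite /p /s; field.
    + by apply: (half _ _ ca); rewrite /s; field.
  - split; [by split|split].
    + by apply: (half _ _ ab); rewrite /p; field.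
    + by apply: (half _ _ bc); rewrite /q; field.
    + by apply: (half _ _ ca); rewrite /p /q; field.
  - split; [by split|split].
    + by apply: (half _ _ ab); rewrite /q /s; field.
    + by apply: (half _ _ bc); rewrite /q; field.
    + by apply: (half _ _ ca); rewrite /s; field.
  - split; [by split|split].
    + by apply: (half _ _ ac); rewrite /p /q; field.
    + by apply: (half _ _ ba); rewrite /q /s; field.
    + by apply: (half _ _ cb); rewrite /p /s; field.
have tot : tri_val f (a, b, c, d) <= normc (triint f a p s) + normc (triint f p b q)
    + normc (triint f s q c) + normc (triint f p q s).
  rewrite /tri_val (triint_mid cf ar br cr).
  apply: (le_trans (ler_normcD _ _)); rewrite lerD2r.
  apply: (le_trans (ler_normcD _ _)); rewrite lerD2r.
  exact: ler_normcD.
suff [T TTs hT] : exists2 T, T \in Ts & tri_val f (a, b, c, d) <= 4 * tri_val f T.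
  by have [h1 h2 h3] := inv T TTs; exists T.
(* If all four fell short, the sum of the four strict inequalities would contradict [tot]. *)
apply: contrapT => no.
have lt T : T \in Ts -> 4 * tri_val f T < tri_val f (a, b, c, d).
  by move=> TTs; rewrite ltNge; apply/negP => h; apply: no; exists T.
have := lt (a, p, s, d / 2); have := lt (p, b, q, d / 2).
have := lt (s, q, c, d / 2); have := lt (p, q, s, d / 2).
rewrite !inE !eqxx !orbT /= => /(_ isT) l1 /(_ isT) l2 /(_ isT) l3 /(_ isT) l4.
move: tot; rewrite /=; clear -l1 l2 l3 l4; rewrite /= in l1 l2 l3 l4; lra.
Qed.

(** The open-disc statement [segment_disc], used with radius del + e for every e > 0. *)
Lemma segment_closed_disc (x u v : C) (del t : R) : t \in `[0, 1] ->
  normc (u - x) <= del -> normc (v - x) <= del ->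
  normc (u + t%:C * (v - u) - x) <= del.
Proof.
move=> t01 ux vx; apply/ler_addgt0Pr => e e0; apply: ltW.
have -> : u + t%:C * (v - u) - x = (u - x) + t%:C * ((v - x) - (u - x)) :> R[i] by ring.
by apply: (segment_disc t01); [apply: (le_lt_trans ux)|apply: (le_lt_trans vx)]; rewrite ltrDl.
Qed.

Lemma goursat_triangle r f a b c :
  (forall z : C, normc z < r -> derivable f z 1) ->
  normc a < r -> normc b < r -> normc c < r -> triint f a b c = 0.
Proof.
move=> df ar br cr.
have cf : fcont r f.
  by move=> z zr; apply: differentiable_continuous; apply/derivable1_diffP; exact: df.
pose d := normc (b - a) + normc (c - b) + normc (a - c).
have n1 := normc_ge0 (b - a); have n2 := normc_ge0 (c - b); have n3 := normc_ge0 (a - c).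
have d0 : 0 <= d by rewrite /d !addr_ge0.
pose r' := (Num.max (normc a) (Num.max (normc b) (normc c)) + r) / 2.
have mr : Num.max (normc a) (Num.max (normc b) (normc c)) < r by rewrite !gt_max ar br cr.
have r'r : r' < r by rewrite /r'; lra.
have [ar' br' cr'] : [/\ normc a < r', normc b < r' & normc c < r'].
  by have := mr; rewrite !gt_max => /and3P[h1 h2 h3]; split;
  apply: (@le_lt_trans _ _ (Num.max (normc a) (Num.max (normc b) (normc c))));
  rewrite ?le_max ?lexx ?orbT//; rewrite /r'; lra.
have cf' : fcont r' f by move=> z zr; apply: cf; exact: lt_trans r'r.
have T0i : tri_inv r' (a, b, c, d) by do 2!split => //; rewrite /d; lra.
(* The implication makes [step] total: a tuple violating the invariant may be sent anywhere. *)
have /choice[step hstep] : forall T, exists T' : C * C * C * R, tri_inv r' T ->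
   [/\ tri_inv r' T', T'.2 = T.2 / 2,
    normc (T'.1.1.1 - T.1.1.1) <= T.2 & tri_val f T <= 4 * tri_val f T'].
  move=> T; have [i|ni] := pselect (tri_inv r' T); last by exists T.
  by have [T' h] := tri_step cf' i; exists T'.
pose T n := iter n step (a, b, c, d).
have Ti n : tri_inv r' (T n) /\ (T n).2 = d * 2^-1 ^+ n.
  elim: n => [|n [i e]]; first by split => //=; rewrite expr0 mulr1.
  have [h1 h2 h3 h4] := hstep _ i.
  by split => //; rewrite /T iterS h2 e exprSr mulrA.
have Tv n : tri_val f (a, b, c, d) <= 4 ^+ n * tri_val f (T n).
  elim: n => [|n /le_trans]; first by rewrite expr0 mul1r.
  apply; have [_ _ _ h4] := hstep _ (Ti n).1.
  by rewrite exprSr -mulrA; apply: ler_wpM2l => //; exact: exprn_ge0.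
pose A n : C := (T n).1.1.1.
have AS n : normc (A n.+1 - A n) <= d * 2^-1 ^+ n.
  by have [i e] := Ti n; have [_ _ h3 _] := hstep _ i; rewrite -e.
have [p1 hp1] : exists p, forall n, `|Re (A n) - p| <= 2 * d * 2^-1 ^+ n.
  by apply: geometric_limit => n; rewrite -raddfB; exact: le_trans (ler_Re_normc _) (AS n).
have [p2 hp2] : exists p, forall n, `|Im (A n) - p| <= 2 * d * 2^-1 ^+ n.
  by apply: geometric_limit => n; rewrite -raddfB; exact: le_trans (ler_Im_normc _) (AS n).
pose p : C := p1 +i* p2.
have hp n : normc (A n - p) <= 4 * (d * 2^-1 ^+ n).
  apply: (le_trans (ler_normc_ReIm _)); rewrite !raddfB/=.
  by have := hp1 n; have := hp2 n; lra.
have e2 : (fun n => 2^-1 ^+ n : R) @ \oo --> (0 : R).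
  by apply: cvg_expr; rewrite ger0_norm ?invr_ge0// invf_lt1// ltr1n.
have small (e : R) : 0 < e -> \forall n \near \oo, d * 2^-1 ^+ n < e.
  move=> e0.
  have : (fun n => d * 2^-1 ^+ n : R) @ \oo --> d * 0 by apply: cvgM => //; exact: cvg_cst.
  rewrite mulr0 => /cvgrPdist_lt/(_ _ e0); apply: filterS => n.
  by rewrite sub0r normrN; apply: le_lt_trans; exact: ler_norm.
have AR n : normc (A n) < r'.
  by have [] := Ti n; rewrite /A; case: (T n) => [[[x y] z] t] [[]].
have pr : normc p < r.
  apply: (le_lt_trans _ r'r); apply/ler_addgt0Pr => e e0.
  have [n hn] : exists n, d * 2^-1 ^+ n < e / 4.
    have : 0 < e / 4 by rewrite divr_gt0.
    by move/small => [n _ hn]; exists n; exact: hn n (leqnn n).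
  rewrite -(subrK (A n) p) addrC.
  apply: (le_trans (ler_normcD _ _)); apply: lerD; first exact: ltW.
  by rewrite normc_distC; apply: (le_trans (hp n)); lra.
have : is_derive p 1 f ('D_1 f p) by exact/derivableP/df.
set D := 'D_1 f p => /cderP fp.
(* The affine approximation of [f] at [p] has the primitive [G], so its triangle integrals vanish
   and only the remainder f - g contributes. *)
pose g (z : C) : C := f p + D * (z - p).
pose G (z : C) : C := f p * z + D * (2^-1 * (z - p) ^+ 2).
have dG (z : C) : is_derive z 1 G (g z).
  apply/cderP => e e0.
  have K0 : 0 < normc (D * 2^-1) + 1 by rewrite ltr_wpDl// normc_ge0.
  near=> h.
  have -> : G (z + h) - G z - g z * h = D * 2^-1 * h * h by rewrite /G /g; field.
  rewrite normcM; apply: ler_wpM2r; first exact: normc_ge0.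
  have hK : normc (0 - h) < e / (normc (D * 2^-1) + 1).
    by near: h; exact: (near_normc_lt (0 : C) (divr_gt0 e0 K0)).
  rewrite sub0r normcNE ltr_pdivlMr// in hK.
  by rewrite normcM; have := normc_ge0 h; lra.
have cg : fcont r g.
  move=> z _; apply: (@continuousD _ C _ (fun=> f p) (fun z => D * (z - p))); first exact: cst_continuous.
  apply: (@continuousM R[i] _ (fun=> D) (fun z : C => z - p)); first exact: cst_continuous.
  apply: (@continuousB _ C _ id (fun=> p)); last exact: cst_continuous.
  exact: cvg_id.
have tg x y z : normc x < r -> normc y < r -> normc z < r -> triint g x y z = 0.
  move=> xr yr zr; have dG' (w : C) : normc w < r -> is_derive w 1 G (g w) by [].
  rewrite /triint (segintE cg dG' xr yr) (segintE cg dG' yr zr) (segintE cg dG' zr xr).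
  ring.
(* 30 = 3 * 2 * 5: three sides, the 2 of [normc_segint_le], and points of the n-th triangle lie
   within 5 d 2^-n of [p] (4 for its first vertex, 1 for its size). *)
have key (e : R) : 0 < e -> tri_val f (a, b, c, d) <= 30 * e * d ^+ 2.
  move=> e0; have := fp e e0.
  move=> /nbhs_ballP[/= k0]; rewrite /= ltcE => /andP[/eqP/= Ik Rk] hk.
  have [n hn] : exists n, d * 2^-1 ^+ n < Re k0 / 5.
    have : 0 < Re k0 / 5 by rewrite divr_gt0.
    by move/small => [n _ hn]; exists n; exact: hn n (leqnn n).
  have fg (w : C) : normc (w - A n) <= d * 2^-1 ^+ n ->
      normc (f w - g w) <= e * (5 * (d * 2^-1 ^+ n)).
    move=> wA.
    have wp : normc (w - p) <= 5 * (d * 2^-1 ^+ n).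
      rewrite -(subrKA (A n)); apply: (le_trans (ler_normcD _ _)).
      by have := hp n; lra.
    have : normc (f (p + (w - p)) - f p - D * (w - p)) <= e * normc (w - p).
      apply: hk; rewrite -ball_normE/= sub0r normrN normrE_normc.
      rewrite ltcE /= Ik eqxx /=; lra.
    rewrite (addrC p) subrK => h.
    rewrite /g opprD addrA; apply: (le_trans h).
    by apply: ler_wpM2l => //; exact: ltW.
  have [i Td] := Ti n; have := Tv n.
  rewrite /A in fg hp; move: i Td fg; case: (T n) => [[[x y] z] t] [[xr yr zr] [xy yz zx]] tE fg; rewrite /= in tE fg.
  rewrite {}tE in xy yz zx.
  have xr1 := lt_trans xr r'r; have yr1 := lt_trans yr r'r; have zr1 := lt_trans zr r'r.
  move=> /le_trans; apply.
  rewrite /tri_val -[triint f x y z]subr0 -(tg x y z)//.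
  have -> : triint f x y z - triint g x y z = triint (fun w => f w - g w) x y z.
    rewrite /triint (segintB cf cg xr1 yr1) (segintB cf cg yr1 zr1) (segintB cf cg zr1 xr1).
    ring.
  have cfg : fcont r (fun w => f w - g w).
    by move=> w wr; apply: (@continuousB _ C _ f g); [exact: cf|exact: cg].
  set del := d * 2^-1 ^+ n in xy yz zx fg *.
  have del0 : 0 <= del by exact: le_trans (normc_ge0 _) xy.
  have xx : normc (x - x) <= del by rewrite subrr (eqP (_ : normc (0 : R[i]) == 0)) ?normc_eq0.
  have yx : normc (x - y) <= del by rewrite normc_distC.
  have xz : normc (z - x) <= del by rewrite normc_distC.
  have bd (u v : C) : normc u < r -> normc v < r -> normc (u - x) <= del ->
      normc (v - x) <= del -> normc (v - u) <= del ->
      normc (segint (fun w => f w - g w) u v) <= 10 * e * del ^+ 2.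
    move=> ur vr ux vx uv.
    apply: (@le_trans _ _ (2 * (e * (5 * del)) * normc (v - u))).
      apply: (normc_segint_le cfg ur vr) => s s01.
      by apply: fg; exact: segment_closed_disc.
    have -> : 10 * e * del ^+ 2 = 2 * (e * (5 * del)) * del by ring.
    by apply: ler_wpM2l => //; rewrite !mulr_ge0// ltW.
  apply: (@le_trans _ _ (4 ^+ n * (30 * e * del ^+ 2))).
    apply: ler_wpM2l; first exact: exprn_ge0.
    have -> : 30 * e * del ^+ 2 = 10 * e * del ^+ 2 + 10 * e * del ^+ 2 + 10 * e * del ^+ 2 by ring.
    apply: (le_trans (ler_normcD _ _)); apply: lerD; last exact: bd.
    by apply: (le_trans (ler_normcD _ _)); apply: lerD; exact: bd.
  (* The factor 4^n lost in the subdivisions is regained from perimeter times distance, of order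
     4^-n. *)
  have E : 4 ^+ n * (2^-1 ^+ n) ^+ 2 = 1 :> R.
    rewrite -exprM mulnC exprM -exprMn.
    have -> : 4 * 2^-1 ^+ 2 = 1 :> R by field.
    exact: expr1n.
  have -> : 4 ^+ n * (30 * e * del ^+ 2) = 30 * e * d ^+ 2 * (4 ^+ n * (2^-1 ^+ n) ^+ 2).
    by rewrite /del; ring.
  by rewrite E mulr1.
apply/eqP; rewrite -normc_eq0; apply/eqP/le_anti; rewrite normc_ge0 andbT leNgt.
apply/negP; set v := normc _ => v0.
have d20 : 0 <= d ^+ 2 by exact: sqr_ge0.
(* With e = v / (60 (d^2 + 1)), [key] would give v <= v / 2. *)
have k0 : 0 < 60 * (d ^+ 2 + 1) by rewrite mulr_gt0// ltr_wpDl.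
have := key _ (divr_gt0 v0 k0); rewrite /tri_val -/v.
have : v / (60 * (d ^+ 2 + 1)) * (60 * (d ^+ 2 + 1)) = v by rewrite divfK// gt_eqF.
have : 0 < v / (60 * (d ^+ 2 + 1)) by exact: divr_gt0.
move: (v / _) => u; clear -d20 v0; nra.
Unshelve. all: by end_near. Qed.

End Goursat.

(** * Rules for limits of complex-valued functions *)

Section ComplexLimits.
Context {R : realType} (T : Type) (F : set_system T) {FF : Filter F}.
Local Notation C := (R[i]^o).
Implicit Types (f g : T -> C) (a b : C).

Lemma ccvgD f g a b : f @ F --> a -> g @ F --> b -> (fun x => f x + g x) @ F --> (a + b : C).
Proof. by move=> fa gb; exact: (@cvgD R[i] C T F FF f g a b fa gb). Qed.

Lemma ccvgN f a : f @ F --> a -> (fun x => - f x) @ F --> (- a : C).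
Proof. by move=> fa; exact: (@cvgN R[i] C T F FF f a fa). Qed.

Lemma ccvgB f g a b : f @ F --> a -> g @ F --> b -> (fun x => f x - g x) @ F --> (a - b : C).
Proof. by move=> fa gb; exact: (ccvgD fa (ccvgN gb)). Qed.

Lemma ccvgM f g a b : f @ F --> a -> g @ F --> b -> (fun x => f x * g x) @ F --> (a * b : C).
Proof. by move=> fa gb; exact: (@cvgM R[i] T F FF f g a b fa gb). Qed.

Lemma ccvgV f a : a != 0 -> f @ F --> a -> (fun x => (f x)^-1) @ F --> (a^-1 : C).
Proof. by move=> a0 fa; exact: (@cvgV R[i] T F FF f a a0 fa). Qed.

Lemma ccvg_cst a : (fun=> a) @ F --> a.
Proof. exact: cvg_cst. Qed.

Lemma ccvgX f a n : f @ F --> a -> (fun x => f x ^+ n) @ F --> (a ^+ n : C).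
Proof.
move=> fa; elim: n => [|n IH].
  by under eq_fun do rewrite expr0; exact: ccvg_cst.
by under eq_fun do rewrite exprS; rewrite exprS; exact: ccvgM.
Qed.

Lemma ccvg_sum n (f : 'I_n -> T -> C) (a : 'I_n -> C) :
  (forall i, f i @ F --> a i) -> (fun x => \sum_i f i x) @ F --> (\sum_i a i : C).
Proof.
elim: n f a => [|n IH] f a fa.
  by under eq_fun do rewrite big_ord0; rewrite big_ord0; exact: ccvg_cst.
under eq_fun do rewrite big_ord_recr/=; rewrite big_ord_recr/=.
by apply: ccvgD; [apply: IH|].
Qed.

End ComplexLimits.

(** * Cauchy's formula *)

Section Cauchy.
Context {R : realType}.
Local Notation C := (R[i]^o).

(** Continuity of [k0] turns joint convergence to [k0 x] into joint convergence of the difference to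
    0. *)
Lemma cint_cvg_joint (T : Type) (F : set_system T) (FF : Filter F) (a b : R)
    (k : T -> R -> C) (k0 : R -> C) :
  a <= b -> (\forall p \near F, in_cont a b (k p)) -> in_cont a b k0 ->
  (forall x, x \in `[a, b] -> (fun q : R * T => k q.2 q.1) @ (nbhs x, F) --> k0 x) ->
  (fun p => cint a b (k p)) @ F --> cint a b k0.
Proof.
move=> ab ck ck0 kk0; apply: (cint_cvg FF ab ck ck0) => x xab.
have f1 : (fun q : R * T => q.1) @ (nbhs x, F) --> x by exact: cvg_fst.
have f2 : (fun q : R * T => k0 q.1) @ (nbhs x, F) --> k0 x := cvg_comp _ _ f1 (ck0 x xab).
apply/cvgcP => e e0; have e20 : 0 < e / 2 by rewrite divr_gt0.
have /cvgcP/(_ _ e20) n1 := kk0 x xab.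
have /cvgcP/(_ _ e20) n2 := f2.
near=> q; rewrite sub0r normcNE (splitr e).
have -> : k q.2 q.1 - k0 q.1 = (k0 x - k0 q.1) - (k0 x - k q.2 q.1).
  by rewrite opprB [RHS]addrC addrA subrK.
apply: (le_lt_trans (ler_normcD _ _)); rewrite normcNE.
by apply: ltrD; near: q.
Unshelve. all: by end_near. Qed.

Definition holo (r : R) (f : C -> C) := forall z : C, normc z < r -> derivable f z 1.

Lemma holo_fcont r f : holo r f -> fcont r f.
Proof.
by move=> df z zr; apply: differentiable_continuous; apply/derivable1_diffP; exact: df.
Qed.

(** Goursat's theorem on the triangle 0, z, z + h reduces the increment of the primitive to an
    integral over [z, z + h], where [f] is close to [f z]. *)
Lemma holo_primitive r f : 0 < r -> holo r f ->
  forall z : C, normc z < r -> is_derive z 1 (segint f 0) (f z).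
Proof.
move=> r0 df z zr; have cf := holo_fcont df.
have r0' : normc (0 : R[i]) < r by rewrite normc0.
apply/cderP => e e0.
have e20 : 0 < e / 2 by rewrite divr_gt0.
have := near_normc0 e20 (cf z zr) => /nbhs_ballP[/= k0].
rewrite /= ltcE => /andP[/eqP/= Ik Rk] hk.
(* [h] must stay within the continuity radius at [z] and keep z + h in the disc. *)
have Rk0 : 0 < Num.min (Re k0) (r - normc z) by rewrite lt_min Rk subr_gt0.
have := near_normc_lt (0 : C) Rk0; apply: filterS => h; rewrite sub0r normcNE lt_min => /andP[hk1 hr].
have zhr : normc (z + h) < r by apply: (le_lt_trans (ler_normcD _ _)); lra.
have := goursat_triangle df r0' zr zhr; rewrite /triint (segint_rev cf r0' zhr) => /eqP.
rewrite subr_eq0 => /eqP <-; rewrite [segint f 0 z + _]addrC addrK.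
have cg : fcont r (fun=> f z : C) by move=> w _; exact: cst_continuous.
have -> : f z * h = segint (fun=> f z) z (z + h).
  have d (w : C) : normc w < r -> is_derive w 1 (fun w : C => f z * w : C) (f z).
    move=> _; have := is_deriveM (is_derive_cst (f z : C) w 1) (is_derive_id w 1).
    by move=> H; apply: (is_derive_eq H); rewrite /GRing.scale/= mulr0 addr0 mulr1.
  by rewrite (segintE cg d zr zhr) mulrDr addrC addKr.
rewrite -(segintB cf cg zr zhr).
have cfg : fcont r (fun w => f w - f z) by move=> w wr; exact: (ccvgB (cf w wr) (cg w wr)).
have -> : e * normc h = 2 * (e / 2) * normc (z + h - z).
  by rewrite [z + h]addrC addrK; field.
apply: (normc_segint_le cfg zr zhr) => t t01; apply: ltW; apply: hk.
rewrite -ball_normE/= normrE_normc [z + h]addrC addrK opprD addNKr normcNE normcM normc_real.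
move: t01; rewrite in_itv/= => /andP[t0 t1]; rewrite ger0_norm//.
rewrite ltcE/= Ik eqxx/=; apply: le_lt_trans hk1.
by rewrite ler_piMl// normc_ge0.
Qed.

Definition circ (t : R) : C := cos t +i* sin t.

Lemma normc_circ t : normc (circ t) = 1.
Proof. by rewrite /= cos2Dsin2 sqrtr1. Qed.

Lemma circ_neq0 t : circ t != 0.
Proof. by rewrite -normc_gt0 normc_circ. Qed.

Lemma rder_circ t : rder circ t ('i%C * circ t).
Proof.
split; [apply: (is_derive_eq (is_derive_cos t))|apply: (is_derive_eq (is_derive_sin t))] => /=.
  by rewrite mul0r mul1r sub0r.
by rewrite mul0r mul1r add0r.
Qed.

Lemma cont_circ : continuous circ.
Proof. by move=> t; exact: rder_cont (rder_circ t). Qed.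

Lemma circ_sub_neq0 (z : C) t : normc z < 1 -> circ t - z != 0.
Proof.
move=> z1; rewrite subr_eq0; apply/eqP => e; move: z1.
by rewrite -e normc_circ ltxx.
Qed.

Lemma pi2_gt0 : - pi < pi :> R.
Proof. by rewrite gtrN// pi_gt0. Qed.

(** A Cauchy-type integral with arbitrary density on the circle; the exponent [n] makes the family
    stable under differentiation in [z]. *)
Definition cauchy_int (phi : R -> C) (n : nat) (z : C) : C :=
  cint (- pi) pi (fun t => phi t / (circ t - z) ^+ n).

Lemma cauchy_int_cont (phi : R -> C) n (z : C) : in_cont (- pi) pi phi -> normc z < 1 ->
  in_cont (- pi) pi (fun t => phi t / (circ t - z) ^+ n : C).
Proof.
move=> cphi z1 t tpi; apply: (ccvgM (cphi t tpi)).
apply: ccvgV; first by rewrite expf_neq0// circ_sub_neq0.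
by apply: ccvgX; apply: ccvgB; [exact: cont_circ|exact: ccvg_cst].
Qed.

Lemma cauchy_int_derive (phi : R -> C) n (z : C) : in_cont (- pi) pi phi -> normc z < 1 ->
  is_derive z 1 (cauchy_int phi n) (n%:R * cauchy_int phi n.+1 z).
Proof.
move=> cphi z1.
pose k0 t : C := phi t * (n%:R * (circ t - z)^-1 ^+ n.+1).
(* The difference quotient with [h] cancelled by the factorization of x^n - y^n; unlike the
   quotient, it is continuous at h = 0. *)
pose k (h : C) t : C := phi t * ((circ t - (z + h))^-1 * (circ t - z)^-1 *
   \sum_(i < n) ((circ t - (z + h))^-1 ^+ (n.-1 - i) * (circ t - z)^-1 ^+ i)).
have czh : (fun h : C => z + h) @ (0 : C)^' --> z.
  rewrite -[X in _ --> X]addr0; apply: ccvgD; first exact: ccvg_cst.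
  exact: cvg_within.
have near1 : \forall h \near (0 : C)^', normc (z + h) < 1.
  apply: (czh [set w | normc w < 1]); exact: (@open_cdisc R 1 z z1).
have cphiV (w : C) : normc w < 1 -> in_cont (- pi) pi (fun t => (circ t - w)^-1 : C).
  move=> w1 t tpi; apply: ccvgV; first exact: circ_sub_neq0.
  by apply: ccvgB; [exact: cont_circ|exact: ccvg_cst].
have kE (h : C) : h != 0 -> normc (z + h) < 1 ->
    h^-1 *: (cauchy_int phi n (h *: (1 : C) + z) - cauchy_int phi n z) = cint (- pi) pi (k h).
  move=> h0 zh1.
  have -> : h *: (1 : C) + z = z + h by rewrite [_ *: 1]mulr1 addrC.
  rewrite -(cintB (cauchy_int_cont (n := n) cphi zh1) (cauchy_int_cont (n := n) cphi z1)).
  rewrite [_ *: _](_ : _ = h^-1 * cint (- pi) pi (fun t => phi t / (circ t - (z + h)) ^+ n - phi t / (circ t - z) ^+ n))//.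
  rewrite -(cintZ _ (in_contB (cauchy_int_cont (n := n) cphi zh1) (cauchy_int_cont (n := n) cphi z1))).
  apply: eq_cint => t _; rewrite -!exprVn -mulrBr subrXX mulrCA; congr (_ * _).
  rewrite mulrA; congr (_ * _).
  by field; rewrite h0/= !circ_sub_neq0.
have ck0 : in_cont (- pi) pi k0.
  move=> t tpi; apply: (ccvgM (cphi t tpi)); apply: ccvgM; first exact: ccvg_cst.
  by apply: ccvgX; exact: cphiV.
have lim : (fun h => cint (- pi) pi (k h)) @ (0 : C)^' --> cint (- pi) pi k0.
  apply: (cint_cvg_joint _ (ltW pi2_gt0) _ ck0).
    near=> h; have zh1 : normc (z + h) < 1 by near: h.
    move=> t tpi; apply: (ccvgM (cphi t tpi)); apply: ccvgM.
      by apply: ccvgM; exact: cphiV.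
    by apply: ccvg_sum => i; apply: ccvgM; apply: ccvgX; exact: cphiV.
  move=> t tpi.
  have f1 : (fun q : R * C => q.1) @ (nbhs t, (0 : C)^') --> t by exact: cvg_fst.
  have cz1 : (fun q : R * C => circ q.1 - (z + q.2) : C) @ (nbhs t, (0 : C)^') --> (circ t - z : C).
    apply: ccvgB; first exact: (cvg_comp _ _ f1 (@cont_circ t)).
    exact: (cvg_comp _ _ (@cvg_snd _ _ (nbhs t) (0 : C)^' _) czh).
  have cz2 : (fun q : R * C => circ q.1 - z : C) @ (nbhs t, (0 : C)^') --> (circ t - z : C).
    by apply: ccvgB; [exact: (cvg_comp _ _ f1 (@cont_circ t))|exact: ccvg_cst].
  have cz1V : (fun q : R * C => (circ q.1 - (z + q.2))^-1 : C) @ (nbhs t, (0 : C)^') -->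
      ((circ t - z)^-1 : C) by exact: (ccvgV (circ_sub_neq0 t z1) cz1).
  have cz2V : (fun q : R * C => (circ q.1 - z)^-1 : C) @ (nbhs t, (0 : C)^') -->
      ((circ t - z)^-1 : C) by exact: (ccvgV (circ_sub_neq0 t z1) cz2).
  have -> : k0 t = phi t * ((circ t - z)^-1 * (circ t - z)^-1 *
      \sum_(i < n) ((circ t - z)^-1 ^+ (n.-1 - i) * (circ t - z)^-1 ^+ i)).
    rewrite /k0; congr (_ * _).
    rewrite (eq_bigr (fun=> (circ t - z)^-1 ^+ n.-1)); last first.
      move=> [i /= ni] _; by rewrite -exprD subnK// -ltnS (ltn_predK ni).
    rewrite sumr_const card_ord -[X in _ = _ * X]mulr_natl [RHS]mulrCA.
    (* For n = 0 the predecessor is truncated, but the factor n makes both sides 0. *)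
    have [n0|n0] := posnP n; first by rewrite n0 !mul0r.
    congr (_ * _); by rewrite -{1}(prednK n0) !exprS mulrA.
  have lX : (fun q : R * C => \sum_(i < n) ((circ q.1 - (z + q.2))^-1 ^+ (n.-1 - i) * (circ q.1 - z)^-1 ^+ i) : C)
      @ (nbhs t, (0 : C)^') -->
      (\sum_(i < n) ((circ t - z)^-1 ^+ (n.-1 - i) * (circ t - z)^-1 ^+ i) : C).
    by apply: ccvg_sum => i; apply: ccvgM; apply: ccvgX; [exact: cz1V|exact: cz2V].
  exact: (ccvgM (cvg_comp _ _ f1 (cphi t tpi)) (ccvgM (ccvgM cz1V cz2V) lX)).
have k0E : cint (- pi) pi k0 = n%:R * cauchy_int phi n.+1 z.
  rewrite -(cintZ _ (cauchy_int_cont (n := n.+1) cphi z1)); apply: eq_cint => t _.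
  by rewrite /k0 exprVn mulrCA.
have lim2 : h^-1 *: (cauchy_int phi n (h *: (1 : C) + z) - cauchy_int phi n z) @[h --> (0 : C)^'] --> n%:R * cauchy_int phi n.+1 z.
  rewrite -k0E; apply: cvg_trans lim; apply: near_eq_cvg; near=> h.
  have zh1 : normc (z + h) < 1 by near: h.
  have h0 : h != 0 by near: h; rewrite near_withinE; exact: nearW.
  by rewrite (kE h h0 zh1).
by apply: DeriveDef; [apply/cvg_ex; exists (n%:R * cauchy_int phi n.+1 z)|apply: cvg_lim].
Unshelve. all: by end_near. Qed.

End Cauchy.

(** * Cauchy's formula, and differentiability of the derivative *)

Section CauchyFormula.
Context {R : realType}.
Local Notation C := (R[i]^o).
Local Notation mu := (@lebesgue_measure R).

Lemma cder_inv (g : C -> C) (z d : C) : g z != 0 -> is_derive z 1 g d ->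
  is_derive z 1 (fun u => (g u)^-1 : C) (- d / g z ^+ 2).
Proof.
move=> gz dg; have [dgz gd] := dg.
apply: DeriveDef; first exact: derivableV.
have -> : 'D_1 (fun u => (g u)^-1 : C) z = - (g z) ^- 2 *: 'D_1 g z by exact: deriveV.
by rewrite gd [_ *: _]mulrC mulrN mulNr.
Qed.

Lemma circ_npi : circ (- pi) = circ pi :> C.
Proof. by rewrite /circ cosN sinN sinpi oppr0. Qed.

Lemma in_cont_circ a b : in_cont a b (@circ R).
Proof. by move=> t _; exact: cont_circ. Qed.

Lemma cint_periodic (f F : R -> C) : (forall t, {for t, continuous f}) ->
  (forall t, rder F t (f t)) -> F (- pi) = F pi -> cint (- pi) pi f = 0.
Proof.
move=> cf dF e; rewrite (cint_FTC pi2_gt0 (F := F)); first by rewrite e subrr.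
- by move=> t _; exact: cf.
- by move=> t _; exact: dF.
Qed.

Lemma derive0_cst r (f : C -> C) (z : C) : 0 < r ->
  (forall w : C, normc w < r -> is_derive w 1 f 0) -> normc z < r -> f z = f 0.
Proof.
move=> r0 df zr; have r0' : normc (0 : R[i]) < r by rewrite normc0.
have c0 : fcont r (fun=> 0 : C) by move=> w _; exact: cst_continuous.
have d0 (w : C) : normc w < r -> is_derive w 1 (fun=> 0 : C) (0 : C).
  by move=> _; exact: is_derive_cst.
have := segintE c0 df r0' zr; rewrite (segintE c0 d0 r0' zr) subrr => /esym/eqP.
by rewrite subr_eq0 => /eqP.
Qed.

(** The integral is constant in [z]: its derivative integrates circ / (circ - w)^2, which is the
    t-derivative of the periodic function i / (circ - w). At z = 0 the integrand is 1. *)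
Lemma cauchy_circ1 (z : C) : normc z < 1 -> cauchy_int (@circ R) 1 z = 2 * pi%:C.
Proof.
move=> z1.
have dC (w : C) : normc w < 1 -> is_derive w 1 (cauchy_int (@circ R) 1) (0 : C).
  move=> w1; apply: (is_derive_eq (cauchy_int_derive 1 (@in_cont_circ _ _) w1)).
  suff -> : cauchy_int (@circ R) 2 w = 0 by rewrite mulr0.
  apply: (@cint_periodic _ (fun t => 'i%C * (circ t - w)^-1)); last by rewrite circ_npi.
    move=> t; apply: ccvgM; first exact: cont_circ.
    apply: ccvgV; first by rewrite expf_neq0// circ_sub_neq0.
    by apply: ccvgX; apply: ccvgB; [exact: cont_circ|exact: ccvg_cst].
  move=> t.
  have dinv : is_derive (circ t) 1 (fun u : C => (u - w)^-1 : C) (- 1 / (circ t - w) ^+ 2).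
    apply: cder_inv; first exact: circ_sub_neq0.
    apply: (is_derive_eq (is_deriveB (is_derive_id _ _) (is_derive_cst _ _ _))).
    by rewrite subr0.
  apply: (rder_eq (rderM (rder_cst 'i%C t) (rder_comp (rder_circ t) dinv))).
  have i2 : 'i%C * 'i%C = -1 :> R[i] by rewrite -expr2 sqr_i.
  have -> : 'i%C * (- 1 / (circ t - w) ^+ 2 * ('i%C * circ t)) =
    - ('i%C * 'i%C) * (circ t / (circ t - w) ^+ 2) :> R[i] by ring.
  by rewrite mul0r add0r i2 opprK mul1r.
rewrite (derive0_cst ltr01 dC z1).
have -> : cauchy_int (@circ R) 1 0 = cint (- pi) pi (fun=> 1 : C).
  by apply: eq_cint => t _; rewrite subr0 expr1 divff// circ_neq0.
rewrite (cint_FTC pi2_gt0 (F := fun t : R => t%:C : C)).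
- by rewrite rmorphN opprK -mulr2n mulr_natl.
- exact: in_cont_cst.
- by move=> t _; have := rder_real (is_derive_id t (1 : R)).
Qed.

(* With [w t s = z + t (e^(is) - z)], the [t]-derivative of the integral of
   [F (w t s) e^(is) / (e^(is) - z)] is the integral of [F' (w t s) e^(is)],
   which up to the factor [t i] is the [s]-derivative of [F (w t s)]; hence it
   vanishes by periodicity. *)
Section RadialDeformation.
Variables (F F' : C -> C) (r : R) (z : C).
Hypothesis r1 : 1 < r.
Hypothesis z1 : normc z < 1.
Hypothesis dF : forall w : C, normc w < r -> is_derive w 1 F (F' w).
Hypothesis cF' : fcont r F'.

Let w (t s : R) : C := z + t%:C * (circ s - z).
Let m (s : R) : C := circ s / (circ s - z).
Let g (t s : R) : C := F (w t s) * m s.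
Let G (t : R) : C := cint (- pi) pi (g t).

Let cF : fcont r F.
Proof. by move=> u ur; exact: cder_cont (dF ur). Qed.

(** The absolute values keep the bound valid for t slightly outside [0, 1], as [w_near] requires. *)
Let w_bound t s : normc (w t s) <= `|1 - t| * normc z + `|t|.
Proof.
have -> : w t s = (1 - t)%:C * z + t%:C * circ s.
  by rewrite /w rmorphB rmorph1; ring.
by apply: (le_trans (ler_normcD _ _)); rewrite !normcM !normc_real normc_circ mulr1.
Qed.

Let convex_le1 (t : R) : t \in `[0, 1] -> `|1 - t| * normc z + `|t| <= 1.
Proof.
rewrite in_itv/= => /andP[t0 t1]; rewrite !ger0_norm ?subr_ge0//.
have : (1 - t) * normc z <= 1 - t by rewrite ler_piMr ?subr_ge0// ltW.
lra.
Qed.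

Let w_le1 (t s : R) : t \in `[0, 1] -> normc (w t s) <= 1.
Proof.
by move=> t01; exact: le_trans (w_bound t s) (convex_le1 t01).
Qed.

Let w_ltr (t s : R) : t \in `[0, 1] -> normc (w t s) < r.
Proof. by move=> t01; exact: le_lt_trans (w_le1 s t01) r1. Qed.

Let w_near (t : R) : t \in `[0, 1] -> \forall t' \near t, forall s, normc (w t' s) < r.
Proof.
move=> t01; pose b (x : R) := `|1 - x| * normc z + `|x|.
have cb : {for t, continuous b}.
  apply: continuousD; last exact: norm_continuous.
  apply: continuousM; last exact: cst_continuous.
  apply: continuous_comp; last exact: norm_continuous.
  by apply: continuousB; [exact: cst_continuous|exact: cvg_id].
have bt : b t < r by exact: le_lt_trans (convex_le1 t01) r1.
have : \forall x \near t, b x < r by exact: (cvgr_lt _ cb).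
apply: filterS => x bx s.
exact: (le_lt_trans (w_bound x s)).
Qed.

Let cm : forall s : R, {for s, continuous m}.
Proof.
move=> s; apply: ccvgM; first exact: cont_circ.
apply: ccvgV; first exact: circ_sub_neq0.
by apply: ccvgB; [exact: cont_circ|exact: ccvg_cst].
Qed.

Let cw (t : R) : forall s : R, {for s, continuous (w t)}.
Proof.
move=> s; apply: ccvgD; first exact: ccvg_cst.
apply: ccvgM; first exact: ccvg_cst.
by apply: ccvgB; [exact: cont_circ|exact: ccvg_cst].
Qed.

Let cFw (H : C -> C) (t : R) : fcont r H -> (forall s, normc (w t s) < r) ->
  forall s : R, {for s, continuous (fun s : R => H (w t s))}.
Proof. by move=> cH wr s; exact: (cvg_comp _ _ (@cw t s) (cH _ (wr s))). Qed.

Let cg (t : R) : (forall s, normc (w t s) < r) -> in_cont (- pi) pi (g t).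
Proof.
by move=> wr s _; apply: ccvgM; [exact: (cFw cF wr)|exact: cm].
Qed.

Let cG (t : R) : t \in `[0, 1] -> {for t, continuous G}.
Proof.
move=> t01; apply: (cint_cvg_joint _ (ltW pi2_gt0)).
- by apply: filterS (w_near t01) => x; exact: cg.
- by apply: cg => s; exact: w_ltr.
move=> s spi.
have f1 : (fun q : R * R => q.1) @ (nbhs s, nbhs t) --> s by exact: cvg_fst.
have f2 : (fun q : R * R => q.2) @ (nbhs s, nbhs t) --> t by exact: cvg_snd.
have l1 : (fun q : R * R => w q.2 q.1) @ (nbhs s, nbhs t) --> w t s.
  apply: ccvgD; first exact: ccvg_cst.
  apply: ccvgM; first exact: (cvg_comp _ _ f2 (@continuous_real_complex R t)).
  by apply: ccvgB; [exact: (cvg_comp _ _ f1 (@cont_circ R s))|exact: ccvg_cst].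
have l2 : (fun q : R * R => F (w q.2 q.1)) @ (nbhs s, nbhs t) --> F (w t s).
  exact: (cvg_comp _ _ l1 (cF (w_ltr s t01))).
by apply: ccvgM; [exact: l2|exact: (cvg_comp _ _ f1 (@cm s))].
Qed.

Let dg (t s : R) : t \in `[0, 1] -> rder (fun t => g t s) t (F' (w t s) * circ s).
Proof.
move=> t01.
have h := @rder_comp _ F (fun x => w x s) t (circ s - z) _ (@segment_rder _ z (circ s) t) (dF (w_ltr s t01)).
apply: (rder_eq (rderM h (rder_cst (m s) t))).
by rewrite mulr0 addr0 /m -mulrA; congr (_ * _); rewrite mulrC divfK// circ_sub_neq0.
Qed.

(** The primitive in [s] carries the factor 1 / (i t), hence the exclusion of t = 0; that end point
    is reached through the continuity of [G]. *)
Let cint_dg (t : R) : t \in `]0, 1[ -> cint (- pi) pi (fun s => F' (w t s) * circ s) = 0.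
Proof.
move=> t01; have t01' := subset_itv_oo_cc t01.
have t0 : t%:C != 0 :> R[i].
  by move: t01; rewrite in_itv/= => /andP[t0 _]; rewrite eq_complex/= eqxx andbT gt_eqF.
apply: (@cint_periodic _ (fun s => ('i%C * t%:C)^-1 * F (w t s))).
- move=> s; apply: ccvgM; last exact: cont_circ.
  by apply: cFw => // s'; exact: w_ltr.
- move=> s.
  have dw : rder (w t) s (t%:C * ('i%C * circ s)).
    apply: (rder_eq (rderD (rder_cst z s) (rderM (rder_cst t%:C s) (rderD (rder_circ s) (rder_cst (- z) s))))).
    by rewrite add0r mul0r add0r addr0.
  apply: (rder_eq (rderM (rder_cst (('i%C * t%:C)^-1) s) (rder_comp dw (dF (w_ltr s t01'))))).
  by field; rewrite t0/= eq_complex/= oner_eq0 andbF.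
- by rewrite /w circ_npi.
Qed.

(** Differentiation under the integral and the mean value theorem act on real functions; imaginary
    parts are recovered later by rotating [F]. *)
Let ReG_eq : Re (G 1) = Re (G 0).
Proof.
pose f t s := Re (g t s).
(* On the closed disc, which contains every [w t s] with t in [0, 1], the constant [M] dominates the
   t-derivative of the integrand. *)
have [M hM] : exists M : R, forall u : C, normc u <= 1 -> normc (F' u) <= M.
  have cK : {within [set u : C | normc u <= 1], continuous (fun u : C => normc (F' u))}.
    apply: continuous_in_subspaceT => u /set_mem/= u1.
    have cu := cF' (le_lt_trans u1 r1).
    exact: (cvg_comp _ _ cu (@continuous_normc R (F' u))).
  have K0 : [set u : C | normc u <= 1] !=set0 by exists 0; suff : normc (0 : R[i]) <= 1 by []; rewrite normc0.
  have [c _ hc] := compact_EVT_max K0 (@compact_cdisc R) cK.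
  by exists (normc (F' c)) => u u1; apply: hc; apply/mem_set.
have I01 (t : R) : `]0, 1[%classic t -> t \in `[0, 1] by move=> h; exact: subset_itv_oo_cc.
have dRe (t : R) : t \in `]0, 1[ -> is_derive t 1 (fun t => Re (G t)) 0.
  move=> t01.
  have Ia : `]0, 1[%classic t by [].
  have intf (x : R) : `]0, 1[%classic x -> mu.-integrable `[- pi, pi] (EFin \o f x).
    by move=> /I01 x01; apply: in_cont_integrable (in_cont_Re (cg _)) => s; exact: w_ltr.
  have df (x s : R) : `]0, 1[%classic x -> is_derive x 1 (f^~ s) (Re (F' (w x s) * circ s)).
    by move=> /I01 x01; exact: (dg s x01).1.
  have derf (x s : R) : `]0, 1[%classic x -> `[- pi, pi]%classic s -> derivable (f^~ s) x 1.
    by move=> x01 _; have [] := df x s x01.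
  have M0 : 0 <= M by apply: le_trans (normc_ge0 _) (hM 0 _); rewrite normc0.
  have intM : mu.-integrable `[- pi, pi] (EFin \o (fun _ : R => M)).
    by apply: in_cont_integrable => s _; exact: cst_continuous.
  have d1E (x s : R) : `]0, 1[%classic x -> partial1of2 f x s = Re (F' (w x s) * circ s).
    by move=> x01; rewrite partial1of2E; have [] := df x s x01.
  have fM (x s : R) : `]0, 1[%classic x -> `[- pi, pi]%classic s -> `|partial1of2 f x s| <= M.
    move=> x01 _; rewrite d1E//; apply: (le_trans (ler_Re_normc _)).
    by rewrite normcM normc_circ mulr1; apply: hM; apply: w_le1; exact: I01.
  have GE : (fun t => Re (G t)) = (fun t' => (\int[mu]_(s in `[(- pi), pi]) f t' s)%R) by [].
  have D1 := fun mB => derivable_under_integral mB Ia intf derf (fun _ => M0) intM fM.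
  have D2 := fun mB => differentiation_under_integral mB Ia intf derf (fun _ => M0) intM fM.
  rewrite GE; apply: DeriveDef; first by apply: D1; exact: measurable_itv.
  rewrite -derive1E D2; last exact: measurable_itv.
  rewrite -[RHS](_ : Re (cint (- pi) pi (fun s => F' (w t s) * circ s)) = 0); last by rewrite cint_dg.
  by rewrite Re_cint; apply: eq_Rintegral => s _; rewrite d1E.
have dRe' (t : R) : t \in `]0, 1[ -> is_derive t 1 (fun t => Re (G t)) ((fun=> 0) t) by exact: dRe.
have cRe : {within `[0, 1], continuous (fun t => Re (G t))}.
  apply: in_within => t t01; exact: (cvg_comp _ _ (cG t01) (@continuous_Re R (G t))).
have [c _] := MVT ltr01 dRe' cRe.
by rewrite mul0r => /eqP; rewrite subr_eq0 => /eqP.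
Qed.

Lemma Re_radial_deformation :
  Re (cint (- pi) pi (fun s => F (circ s) * m s)) = Re (cint (- pi) pi (fun s => F z * m s)).
Proof.
have -> : (fun s => F (circ s) * m s) = g 1.
  by apply/funext => s; rewrite /g /w mul1r addrC subrK.
have -> : (fun s => F z * m s) = g 0.
  by apply/funext => s; rewrite /g /w mul0r addr0.
exact: ReG_eq.
Qed.

End RadialDeformation.

(** Continuity of [F'] is assumed because it is not yet known for holomorphic functions; primitives
    of holomorphic functions satisfy it. *)
Lemma cauchy_formula_C1 (F F' : C -> C) (r : R) (z : C) : 1 < r -> normc z < 1 ->
  (forall w : C, normc w < r -> is_derive w 1 F (F' w)) -> fcont r F' ->
  cint (- pi) pi (fun s => F (circ s) * (circ s / (circ s - z))) = 2 * pi%:C * F z.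
Proof.
move=> r1 z1 dF cF'.
have cm : in_cont (- pi) pi (fun s => circ s / (circ s - z) : C).
  move=> s _; apply: ccvgM; first exact: cont_circ.
  apply: ccvgV; first exact: circ_sub_neq0.
  by apply: ccvgB; [exact: cont_circ|exact: ccvg_cst].
have -> : 2 * pi%:C * F z = cint (- pi) pi (fun s => F z * (circ s / (circ s - z))).
  by rewrite (cintZ _ cm) mulrC -(cauchy_circ1 z1).
(* Multiplication by -i moves the imaginary part to the real part, so the deformation lemma for -i F
   settles the imaginary part. *)
have ReNi (a b : R[i]) : Re (- 'i%C * a * b) = Im (a * b).
  by case: a b => ? ? [? ?] /=; ring.
apply: complex_eq; first exact: (Re_radial_deformation r1 z1 dF cF').
have dNiF (w : C) : normc w < r -> is_derive w 1 (fun u => - 'i%C * F u : C) (- 'i%C * F' w).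
  move=> wr; have := is_deriveM (is_derive_cst (- 'i%C : C) w 1) (dF w wr).
  by move=> H; apply: (is_derive_eq H); rewrite scaler0 addr0.
have cNiF' : fcont r (fun u => - 'i%C * F' u).
  by move=> w wr; exact: (ccvgM (@cst_continuous C C (- 'i%C) w) (cF' w wr)).
have := Re_radial_deformation r1 z1 dNiF cNiF'.
rewrite !Re_cint !Im_cint.
under eq_Rintegral do rewrite ReNi.
by under [X in _ = X -> _]eq_Rintegral do rewrite ReNi.
Qed.

Lemma cder_unique_near (f g : C -> C) (r : R) (z d e : C) :
  (forall w : C, normc w < r -> f w = g w) -> normc z < r ->
  is_derive z 1 f d -> is_derive z 1 g e -> d = e.
Proof.
move=> fg zr [_ <-] [_ <-]; apply: near_eq_derive.
have : \forall w \near z, normc w < r := @open_cdisc R r z zr.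
by apply: filterS => w; exact: fg.
Qed.

Lemma near_derivable (f g : C -> C) (r : R) (z : C) :
  (forall w : C, normc w < r -> f w = g w) -> normc z < r ->
  derivable f z 1 -> derivable g z 1.
Proof.
move=> fg zr; apply: near_eq_derivable.
have : \forall w \near z, normc w < r := @open_cdisc R r z zr.
by apply: filterS => w; exact: fg.
Qed.

Lemma cderZ (k : C) (f : C -> C) (z d : C) : is_derive z 1 f d ->
  is_derive z 1 (fun u => k * f u : C) (k * d).
Proof.
move=> df; have H := is_deriveM (is_derive_cst k z 1) df.
by apply: (is_derive_eq H); rewrite scaler0 addr0.
Qed.

(** The primitive [F] of [f] is a Cauchy integral on the unit disc. Hence so are [f] (exponent 2)
    and its derivative (exponent 3), which can be differentiated once more. *)
Lemma holo_derivative_disc r (f : C -> C) : 1 < r -> holo r f -> holo 1 ('D_1 f).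
Proof.
move=> r1 df.
pose F := segint f 0.
have dF := holo_primitive (lt_trans ltr01 r1) df; rewrite -/F in dF.
pose phi s : C := F (circ s) * circ s.
have cphi : in_cont (- pi) pi phi.
  move=> s _; apply: ccvgM; last exact: cont_circ.
  have sr : normc (circ s : C) < r by rewrite normc_circ.
  exact: (cvg_comp _ _ (@cont_circ R s) (cder_cont (dF _ sr))).
pose k : C := (2 * pi%:C)^-1.
have k0 : 2 * pi%:C != 0 :> R[i].
  by rewrite mulf_neq0 ?pnatr_eq0// eq_complex/= eqxx andbT gt_eqF// pi_gt0.
have E1 (w : C) : normc w < 1 -> F w = k * cauchy_int phi 1 w.
  move=> w1; have := cauchy_formula_C1 r1 w1 dF (holo_fcont df).
  have -> : cauchy_int phi 1 w = cint (- pi) pi (fun s => F (circ s) * (circ s / (circ s - w))).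
    by apply: eq_cint => s _; rewrite expr1 /phi mulrA.
  by move=> ->; rewrite /k mulKf.
have E2 (w : C) : normc w < 1 -> f w = k * (1%:R * cauchy_int phi 2 w).
  move=> w1; apply: (cder_unique_near E1 w1 (dF w (lt_trans w1 r1))).
  exact: (cderZ k (cauchy_int_derive 1 cphi w1)).
have E2' (w : C) : normc w < 1 -> f w = k * cauchy_int phi 2 w.
  by move=> /E2; rewrite mul1r.
have E3 (w : C) : normc w < 1 -> 'D_1 f w = k * (2%:R * cauchy_int phi 3 w).
  move=> w1; apply: (cder_unique_near E2' w1 (derivableP (df w (lt_trans w1 r1)))).
  exact: (cderZ k (cauchy_int_derive 2 cphi w1)).
move=> z z1; apply: (near_derivable (f := fun w => k * (2%:R * cauchy_int phi 3 w)) _ z1).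
  by move=> w /E3.
by have [] := cderZ k (cderZ 2%:R (cauchy_int_derive 3 cphi z1)).
Qed.

End CauchyFormula.

(** * Holomorphic functions on open sets and the complex exponential *)

Section Holomorphic.
Context {R : realType}.
Local Notation C := (R[i]^o).

Lemma cder_comp (f g : C -> C) (z d1 d2 : C) :
  is_derive z 1 g d1 -> is_derive (g z) 1 f d2 -> is_derive z 1 (fun u => f (g u)) (d2 * d1).
Proof.
move=> [dg <-] [df <-].
have dg' : differentiable g z := (derivable1_diffP g z).1 dg.
have df' : differentiable f (g z) := (derivable1_diffP f (g z)).1 df.
have dfg : differentiable (f \o g) z := differentiable_comp dg' df'.
apply: DeriveDef; first exact: (derivable1_diffP (f \o g) z).2 dfg.
have -> : 'D_1 (fun u => f (g u)) z = 'd (f \o g) z 1 := deriveE (1 : C) dfg.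
have e1 : 'd (f \o g) z (1 : C) = 'd f (g z) ('d g z (1 : C)).
  exact: (congr1 (fun h : C -> C => h 1) (diff_comp dg' df')).
have e2 (h : C) : 'd f (g z) h = h *: derive1 f (g z).
  exact: (congr1 (fun k : C -> C => k h) (diff1E df')).
have e3 : 'D_1 g z = 'd g z 1 := deriveE (1 : C) dg'.
rewrite e1 e2 -e3 derive1E; exact: mulrC.
Qed.

Lemma cderM (f g : C -> C) (z d e : C) : is_derive z 1 f d -> is_derive z 1 g e ->
  is_derive z 1 (fun u => f u * g u : C) (d * g z + f z * e).
Proof.
move=> df dg; apply: (is_derive_eq (is_deriveM df dg)).
by rewrite addrC; congr (_ + _); rewrite [_ *: _]mulrC.
Qed.

Lemma cderD (f g : C -> C) (z d e : C) : is_derive z 1 f d -> is_derive z 1 g e ->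
  is_derive z 1 (fun u => f u + g u : C) (d + e).
Proof. by move=> df dg; exact: is_deriveD. Qed.

Lemma cder_cst (c z : C) : is_derive z 1 (fun=> c) (0 : C).
Proof. exact: is_derive_cst. Qed.

Lemma cder_id (z : C) : is_derive z 1 (fun u : C => u) (1 : C).
Proof. exact: is_derive_id. Qed.

Lemma cder_eq (f : C -> C) (z d e : C) : is_derive z 1 f d -> d = e -> is_derive z 1 f e.
Proof. by move=> ? <-. Qed.

Lemma open_normc (U : set C) (z : C) : open U -> U z ->
  exists2 r : R, 0 < r & forall w : C, normc (w - z) < r -> U w.
Proof.
rewrite openE => /(_ z) h /h /nbhs_ballP[/= k0]; rewrite /= ltcE => /andP[/eqP/= Ik Rk] hk.
exists (Re k0) => // w wz; apply: hk; rewrite -ball_normE/= normrE_normc ltcE/= Ik eqxx/=.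
by rewrite normc_distC.
Qed.

Lemma derivable_derive (U : set C) (f : C -> C) : open U ->
  (forall z, U z -> derivable f z 1) -> forall z, U z -> derivable ('D_1 f) z 1.
Proof.
move=> oU df z Uz; have [r r0 rU] := open_normc oU Uz.
(* The map x -> z + k x sends the disc of radius 2 into [U], so [holo_derivative_disc] applies to
   the rescaled function at 0. *)
pose k : C := (r / 2)%:C.
have r20 : 0 < r / 2 by rewrite divr_gt0.
have k0 : k != 0 by rewrite eq_complex/= eqxx andbT gt_eqF.
have nk : normc k = r / 2 by rewrite normc_real ger0_norm// ltW.
have zkU (x : C) : normc x < 2 -> U (z + k * x).
  move=> x2; apply: rU; rewrite [z + _]addrC addrK normcM nk.
  by rewrite -[ltRHS](divfK (x := 2)) ?ltr_pM2l// pnatr_eq0.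
have daff (x : C) : is_derive x 1 (fun x => z + k * x : C) k.
  apply: (cder_eq (cderD (cder_cst z x) (cderZ k (cder_id x)))).
  by rewrite add0r mulr1.
pose phi x := f (z + k * x).
have dphi (x : C) : normc x < 2 -> is_derive x 1 phi ('D_1 f (z + k * x) * k).
  by move=> x2; exact: (cder_comp (daff x) (derivableP (df _ (zkU _ x2)))).
have hphi : holo 2 phi by move=> x /dphi[].
have n0 : normc (0 : C) < 1 by rewrite normc0.
have h := holo_derivative_disc (ltr1n _ 2) hphi n0.
have dinv : is_derive z 1 (fun u => k^-1 * (u - z) : C) (k^-1).
  apply: (cder_eq (cderZ k^-1 (cderD (cder_id z) (cder_cst (- z) z)))).
  by rewrite addr0 mulr1.
have dc : is_derive z 1 (fun u => k^-1 * 'D_1 phi (k^-1 * (u - z)) : C)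
    (k^-1 * ('D_1 ('D_1 phi) 0 * k^-1)).
  apply: cderZ; apply: (@cder_comp ('D_1 phi) _ z _ _ dinv).
  by rewrite subrr mulr0; exact: derivableP.
have [+ _] := dc; apply: near_eq_derivable.
apply: filterS (near_normc_lt z r0) => u uz.
have ux : normc (k^-1 * (u - z)) < 2.
  rewrite normcM normcV nk normc_distC mulrC ltr_pdivrMr//.
  by rewrite mulrC divfK// pnatr_eq0.
have [_ ->] := dphi _ ux.
have -> : z + k * (k^-1 * (u - z)) = u by rewrite mulVKf// addrC subrK.
by rewrite mulrCA mulVf// mulr1.
Qed.

Lemma open_holo_derive r (f : C -> C) : holo r f -> holo r ('D_1 f).
Proof. exact: derivable_derive (@open_cdisc R r). Qed.

Lemma cauchy_formula (f : C -> C) (r : R) (z : C) : 1 < r -> normc z < 1 -> holo r f ->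
  cint (- pi) pi (fun s => f (circ s) * (circ s / (circ s - z))) = 2 * pi%:C * f z.
Proof.
move=> r1 z1 df; apply: (cauchy_formula_C1 r1 z1 (F' := 'D_1 f)).
  by move=> w wr; exact: derivableP (df w wr).
exact: holo_fcont (open_holo_derive df).
Qed.

Lemma complex_expD (z w : R[i]) : complex_exp (z + w) = complex_exp z * complex_exp w.
Proof.
case: z w => a b [c d]; rewrite /complex_exp /= expRD cosD sinD.
by apply: complex_eq => /=; ring.
Qed.

Lemma is_derive_complex_exp (z : C) : is_derive z 1 (@complex_exp R : C -> C) (complex_exp z).
Proof.
apply/cderP => e e0.
have K0 : 0 < normc (complex_exp z) + 1 by rewrite ltr_wpDl// normc_ge0.
(* Three error terms of size e' |h|, multiplied by |exp z|, stay below e |h|. *)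
pose e' := e / (4 * (normc (complex_exp z) + 1)).
have e'0 : 0 < e' by rewrite divr_gt0// mulr_gt0.
have n1 : \forall x \near (0 : R), `|expR x - 1 - x| <= e' * `|x|.
  have /is_derive_littleoP/(_ _ e'0) := @is_derive_expR R 0.
  by apply: filterS => x; rewrite add0r expR0 mul1r.
have c0 : circ (0 : R) = 1 by rewrite /circ cos0 sin0.
have n2 : \forall y \near (0 : R), normc (circ y - 1 - 'i%C * y%:C) <= e' * `|y|.
  have /rderP/(_ _ e'0) := rder_circ (0 : R).
  by apply: filterS => y; rewrite add0r c0 mulr1.
have n3 : \forall y \near (0 : R), normc (circ y - 1) < e'.
  by have := near_normc0 e'0 (@cont_circ R 0); rewrite c0.
have m1 := @continuous_Re R 0 _ n1.
have m2 := @continuous_Im R 0 _ n2.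
have m3 := @continuous_Im R 0 _ n3.
near=> h.
have h1 : `|expR (Re h) - 1 - Re h| <= e' * `|Re h| by near: h; exact: m1.
have h2 : normc (circ (Im h) - 1 - 'i%C * (Im h)%:C) <= e' * `|Im h| by near: h; exact: m2.
have h3 : normc (circ (Im h) - 1) < e' by near: h; exact: m3.
(* With h = x + i y, the remainder exp h - 1 - h splits into the remainder of e^x, the remainder of
   e^(iy), and the cross term x (e^(iy) - 1). *)
have -> : complex_exp (z + h) - complex_exp z - complex_exp z * h =
    complex_exp z * ((expR (Re h) - 1 - Re h)%:C * circ (Im h)
    + (circ (Im h) - 1 - 'i%C * (Im h)%:C) + (Re h)%:C * (circ (Im h) - 1)).
  have eh : complex_exp h = (expR (Re h))%:C * circ (Im h) by [].
  have <- : complex_exp h - 1 - h = (expR (Re h) - 1 - Re h)%:C * circ (Im h)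
      + (circ (Im h) - 1 - 'i%C * (Im h)%:C) + (Re h)%:C * (circ (Im h) - 1).
    rewrite eh [X in _ - X = _]complexE !rmorphB rmorph1; ring.
  by rewrite complex_expD !mulrBr mulr1.
rewrite normcM.
have bd : normc ((expR (Re h) - 1 - Re h)%:C * circ (Im h)
    + (circ (Im h) - 1 - 'i%C * (Im h)%:C) + (Re h)%:C * (circ (Im h) - 1)) <= 3 * e' * normc h.
  have r1 := ler_Re_normc h; have i1 := ler_Im_normc h.
  have -> : 3 * e' * normc h = e' * normc h + e' * normc h + normc h * e' by ring.
  apply: (le_trans (ler_normcD _ _)); apply: lerD; last first.
    by rewrite normcM normc_real; apply: ler_pM => //; [exact: normc_ge0|exact: ltW].
  apply: (le_trans (ler_normcD _ _)); apply: lerD.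
    rewrite normcM normc_real normc_circ mulr1; apply: (le_trans h1).
    by apply: ler_wpM2l => //; exact: ltW.
  by apply: (le_trans h2); apply: ler_wpM2l => //; exact: ltW.
apply: (le_trans (ler_wpM2l (normc_ge0 _) bd)).
have E : e' * (4 * (normc (complex_exp z) + 1)) = e by rewrite /e' divfK// gt_eqF// mulr_gt0.
rewrite mulrA; apply: ler_wpM2r; first exact: normc_ge0.
have P := mulr_ge0 (ltW e'0) (normc_ge0 (complex_exp z)).
move: e'0 E P; clear; move: e' (normc (complex_exp z)) => x k; lra.
Unshelve. all: by end_near. Qed.

Lemma normc_complex_exp (z : C) : normc (complex_exp z) = expR (Re z).
Proof.
by rewrite /complex_exp normcM normc_real normc_circ mulr1 ger0_norm// expR_ge0.
Qed.

End Holomorphic.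

(** * Green's formula on the unit disc *)

Section PlaneMeasure.
Context {R : realType}.
Local Notation C := (R[i]^o).
Local Notation mu := (@lebesgue_measure R).
Local Notation pl := (measurableTypeR R * measurableTypeR R)%type.
Local Notation leb2 := (mu \x mu)%E.

(** Boxes with rational end points form a countable base of the plane, and each is a measurable
    rectangle. *)
Lemma open_measurable_prod (U : set (R * R)) : open U -> measurable (U : set pl).
Proof.
move=> oU.
pose box (q : (rat * rat) * (rat * rat)) : set (R * R) :=
  (`]ratr q.1.1 : R, ratr q.1.2 : R[%classic `*` `]ratr q.2.1 : R, ratr q.2.2 : R[%classic).
have -> : U = \bigcup_q (if `[< box q `<=` U >] then box q else set0).
  apply/seteqP; split => [p Up|p [q _]]; last by case: ifPn => // /asboolP h /h.
  have /nbhs_ballP[e /= e0 eU] : nbhs p U by move: oU; rewrite openE; apply.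
  have [q1 q1p] : exists q : rat, p.1 - e < ratr q < p.1.
    have [|q hq] := @rat_in_itvoo R (p.1 - e) p.1; first by rewrite ltrBlDr ltrDl.
    by exists q; move: hq; rewrite in_itv.
  have [q2 q2p] : exists q : rat, p.1 < ratr q < p.1 + e.
    have [|q hq] := @rat_in_itvoo R p.1 (p.1 + e); first by rewrite ltrDl.
    by exists q; move: hq; rewrite in_itv.
  have [q3 q3p] : exists q : rat, p.2 - e < ratr q < p.2.
    have [|q hq] := @rat_in_itvoo R (p.2 - e) p.2; first by rewrite ltrBlDr ltrDl.
    by exists q; move: hq; rewrite in_itv.
  have [q4 q4p] : exists q : rat, p.2 < ratr q < p.2 + e.
    have [|q hq] := @rat_in_itvoo R p.2 (p.2 + e); first by rewrite ltrDl.
    by exists q; move: hq; rewrite in_itv.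
  exists ((q1, q2), (q3, q4)) => //; rewrite ifT.
    by split; rewrite /= in_itv/=; apply/andP; split; lra.
  apply/asboolP => -[x y] [/=]; rewrite !in_itv/= => hx hy; apply: eU.
  by split; rewrite /ball/= ltr_norml; apply/andP; split; lra.
apply: countable_bigcupT_measurable => // q.
by case: ifPn => _ //; apply: measurableX; exact: measurable_itv.
Qed.

Lemma cont_measurable_prod (D : set (R * R)) (f : R * R -> R) : open D ->
  (forall p, D p -> {for p, continuous f}) -> measurable_fun (D : set pl) (f : pl -> R).
Proof.
move=> oD cf mD; apply: (measurability _ (measurable_realfun.RGenOInfty.measurableE R)) => //.
move=> /= _ [_ [a ->] <-]; apply: open_measurable_prod.
rewrite openE => p [Dp /=]; rewrite in_itv/= andbT => ap.
have n1 : nbhs p D by move: oD; rewrite openE; exact.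
have n2 : \forall q \near p, a < f q by apply: (cvgr_gt _ (cf _ Dp)).
by apply: filterS2 n1 n2 => q Dq aq; split => //=; rewrite in_itv/= aq.
Qed.

Definition pdisc : set (R * R) := @cplx R @^-1` @unit_disc R.

Lemma continuous_cplx : continuous (fun p : R * R => cplx p : C).
Proof. by move=> p; apply: cvgc_ReIm => /=; [exact: cvg_fst|exact: cvg_snd]. Qed.

Lemma open_pdisc : open pdisc.
Proof.
rewrite /pdisc unit_discE.
apply: (@open_comp _ C (fun p : R * R => cplx p : C) (@cdisc R 1)); last exact: open_cdisc.
by move=> p _; exact: continuous_cplx.
Qed.

Lemma pdiscE (p : R * R) : pdisc p <-> p.1 ^+ 2 + p.2 ^+ 2 < 1.
Proof.
rewrite /pdisc unit_discE /cdisc/= -[X in _ <-> _ < X]sqrtr1 -[X in _ <-> X < _]sqr_sqrtr ?addr_ge0 ?sqr_ge0//.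
by rewrite sqrtr1 expr_lt1// sqrtr_ge0.
Qed.

Lemma measurable_pdisc : measurable (pdisc : set pl).
Proof. exact: open_measurable_prod open_pdisc. Qed.

Lemma leb2_pdisc_fin : (leb2 (pdisc : set pl) < +oo)%E.
Proof.
pose B : set pl := `[-1, 1]%classic `*` `[-1, 1]%classic.
have mB : measurable B by apply: measurableX; exact: measurable_itv.
apply: (@le_lt_trans _ _ (leb2 B)).
  apply: le_measure; rewrite ?inE//; first exact: measurable_pdisc.
  move=> [x y] /pdiscE/= xy; split; rewrite /= in_itv/= -ler_norml -sqrtr_sqr -sqrtr1 ler_sqrt//.
    by have := sqr_ge0 y; lra.
  by have := sqr_ge0 x; lra.
rewrite /B product_measure1E; [|exact: measurable_itv|exact: measurable_itv].
have n11 : (-1 : R) < 1 by lra.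
by rewrite /= lebesgue_measure_itv/= lte_fin n11 -EFinD -EFinM ltry.
Qed.

Lemma pdisc_integrable (f : R * R -> R) (M : R) :
  (forall p, pdisc p -> {for p, continuous f}) -> (forall p, pdisc p -> `|f p| <= M) ->
  leb2.-integrable (pdisc : set pl) (EFin \o (f : pl -> R)).
Proof.
move=> cf fM; apply: measurable_bounded_integrable.
- exact: measurable_pdisc.
- exact: leb2_pdisc_fin.
- exact: cont_measurable_prod open_pdisc cf.
- exists M; split; first exact: num_real.
  by move=> x Mx p pD; exact: le_trans (fM p pD) (ltW Mx).
Qed.

End PlaneMeasure.

(** * Iterated integrals over the disc *)

Section Green.
Context {R : realType}.
Local Notation mu := (@lebesgue_measure R).

Definition pnorm (p : R * R) : R := normc (p.1 +i* p.2).

Lemma pnorm_swap x y : pnorm (x, y) = pnorm (y, x).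
Proof. by rewrite /pnorm /= addrC. Qed.

Lemma pnorm_le1 (x y : R) : x ^+ 2 + y ^+ 2 <= 1 -> pnorm (x, y) <= 1.
Proof. by move=> h; rewrite /pnorm/= -sqrtr1 ler_sqrt. Qed.

Lemma pdisc_swap (p : R * R) : pdisc p -> pdisc (p.2, p.1).
Proof. by move=> /pdiscE h; apply/pdiscE; rewrite /= addrC. Qed.

Lemma oo_integral (a b : R) (f : R -> R) : {in `[a, b], continuous f} ->
  (\int[mu]_(x in `]a, b[) (f x)%:E = (\int[mu]_(x in `[a, b]) f x)%:E)%E.
Proof.
move=> cf; have fi := in_cont_integrable cf.
rewrite /Rintegral fineK; last exact: integrable_fin_num.
rewrite -(integral_itv_bndoo true false)//.
apply: (measurable_funS _ _ (measurable_int _ fi)) => //.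
exact: subset_itv_oo_cc.
Qed.

Lemma cvg_pairR (f g : R -> R) (t : R) : {for t, continuous f} -> {for t, continuous g} ->
  (fun t : R => (f t, g t)) @ t --> (f t, g t).
Proof. by move=> cf cg; exact: (cvg_pair cf cg). Qed.

Lemma continuous_idR (t : R) : {for t, continuous (fun t : R => t)}.
Proof. exact: cvg_id. Qed.

Section VerticalDerivative.
Variables (r : R) (f g : R * R -> R).
Hypothesis r1 : 1 < r.
Hypothesis cf : forall p, pnorm p < r -> {for p, continuous f}.
Hypothesis cg : forall p, pnorm p < r -> {for p, continuous g}.
Hypothesis dfg : forall x y, pnorm (x, y) < r -> is_derive y 1 (fun y => f (x, y)) (g (x, y)).

(** Half the length of the vertical chord at abscissa [x]. The real square root is 0 on negative
    arguments, so [s] is continuous on the whole line. *)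
Let s (x : R) := Num.sqrt (1 - x ^+ 2).

Let s_sqr x : x \in `[-1, 1] -> x ^+ 2 + s x ^+ 2 = 1.
Proof.
rewrite in_itv/= => /andP[h1 h2]; rewrite /s sqr_sqrtr; first by rewrite addrC subrK.
by rewrite subr_ge0; nra.
Qed.

Let cs : continuous s.
Proof.
move=> x; apply: continuous_comp; last exact: sqrt_continuous.
by apply: continuousB; [exact: cst_continuous|exact: exprn_continuous].
Qed.

Let lt_r x y : x ^+ 2 + y ^+ 2 <= 1 -> pnorm (x, y) < r.
Proof. by move=> h; exact: le_lt_trans (pnorm_le1 h) r1. Qed.

Let s_ge0 x : 0 <= s x.
Proof. exact: sqrtr_ge0. Qed.

Let section_disc (x y : R) : x \in `]-1, 1[ -> ((x, y) \in pdisc) = (y \in `]- s x, s x[).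
Proof.
move=> x1; have x1' := subset_itv_oo_cc x1; have := s_sqr x1' => e.
rewrite in_itv/= -ltr_norml; apply/idP/idP => [/set_mem/pdiscE/= h|h].
  by rewrite -(@ltr_pXn2r _ 2)// ?nnegrE ?s_ge0// real_normK ?num_real//; lra.
apply/mem_set/pdiscE => /=.
have : `|y| ^+ 2 < s x ^+ 2 by rewrite ltr_pXn2r// ?nnegrE ?s_ge0.
by rewrite real_normK ?num_real//; lra.
Qed.

Let section_empty (x y : R) : x \notin `]-1, 1[ -> (x, y) \notin pdisc.
Proof.
rewrite in_itv/= -ltr_norml -leNgt => x1; apply/negP => /set_mem/pdiscE/= h.
have : 1 <= `|x| ^+ 2 by rewrite expr_ge1.
by rewrite real_normK ?num_real//; have := sqr_ge0 y; lra.
Qed.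

Let section_le (x y : R) : x \in `[-1, 1] -> y \in `[- s x, s x] -> x ^+ 2 + y ^+ 2 <= 1.
Proof.
move=> /s_sqr e; rewrite in_itv/= -ler_norml => h.
have : `|y| ^+ 2 <= s x ^+ 2 by rewrite ler_pXn2r// ?nnegrE ?s_ge0.
by rewrite real_normK ?num_real//; lra.
Qed.

Let section_integral (x : R) : x \in `]-1, 1[ ->
  (\int[mu]_y ((g \_ pdisc) (x, y))%:E = (f (x, s x) - f (x, - s x))%:E)%E.
Proof.
move=> x1; have x1' := subset_itv_oo_cc x1.
have s0 : 0 < s x by rewrite /s sqrtr_gt0; move: x1; rewrite in_itv/= => /andP[h1 h2]; nra.
have -> : (fun y : R => ((g \_ pdisc) (x, y))%:E) =
    ((fun y : R => (g (x, y))%:E) \_ `]- s x, s x[).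
  apply/funext => y; rewrite !patchE section_disc// mem_setE.
  by case: ifP.
rewrite -integral_mkcond.
have cy (h : R * R -> R) (y : R) : {for (x, y), continuous h} -> {for y, continuous (fun y => h (x, y))}.
  move=> ch; have l : (fun y : R => (x, y)) @ y --> (x, y).
    by apply: cvg_pairR; [exact: cst_continuous|exact: continuous_idR].
  exact: (cvg_comp _ _ l ch).
have cgx : {in `[- s x, s x], continuous (fun y => g (x, y))}.
  by move=> y ys; apply: cy; apply: cg; exact: lt_r (section_le x1' ys).
rewrite (oo_integral cgx) (Rint_FTC (F := fun y => f (x, y)))//; first lra.
  exact: in_within.
by move=> y ys; apply: dfg; exact: lt_r (section_le x1' ys).
Qed.

Let b1 (x : R) := f (x, s x).
Let b2 (x : R) := f (x, - s x).

Let cb1 : {in `[-1, 1], continuous b1}.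
Proof.
move=> x x1; have l : (fun x : R => (x, s x)) @ x --> (x, s x).
  by apply: cvg_pairR; [exact: continuous_idR|exact: cs].
apply: (cvg_comp _ _ l); apply: cf; apply: lt_r; by rewrite s_sqr.
Qed.

Let cb2 : {in `[-1, 1], continuous b2}.
Proof.
move=> x x1; have l : (fun x : R => (x, - s x)) @ x --> (x, - s x).
  by apply: (@cvg_pairR (fun x => x) (fun x => - s x)); [exact: continuous_idR|apply: cvgN; exact: cs].
apply: (cvg_comp _ _ l); apply: cf; apply: lt_r; by rewrite sqrrN s_sqr.
Qed.

Let phi (t : R) := f (cos t, sin t) * sin t.

Let cphi (t : R) : {for t, continuous phi}.
Proof.
have l : (fun t : R => (cos t, sin t)) @ t --> (cos t, sin t).
  by apply: cvg_pairR; [exact: continuous_cos|exact: continuous_sin].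
apply: continuousM; last exact: continuous_sin.
apply: (cvg_comp _ _ l); apply: cf; apply: lt_r; by rewrite cos2Dsin2.
Qed.

Let s_cos (t : R) : s (cos t) = `|sin t|.
Proof. by rewrite /s -sin2cos2 sqrtr_sqr. Qed.

Let cos_itv (t : R) : cos t \in `[-1, 1].
Proof. by rewrite in_itv/= cos_geN1 cos_le1. Qed.

(** The substitution x = cos t, made through a primitive [P] of the boundary values; it avoids
    differentiating [s], which fails at the ends of the diameter. *)
Let half_circle (b P : R -> R) (u v : R) : u < v ->
  (forall x : R, x \in `[-1, 1] -> is_derive x 1 P (b x)) ->
  {in `[u, v], forall t : R, b (cos t) = f (cos t, sin t)} ->
  \int[mu]_(t in `[u, v]) phi t = P (cos u) - P (cos v).
Proof.
move=> uv dP bE.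
have d (t : R) : t \in `[u, v] -> is_derive t 1 (fun t => - P (cos t)) (phi t).
  move=> tuv; have h := is_deriveN (is_derive1_comp (dP _ (cos_itv t)) (is_derive_cos t)).
  by apply: (is_derive_eq h); rewrite mulrN opprK bE.
rewrite (Rint_FTC uv _ d); first by rewrite opprK addrC.
by apply: in_within => t _; exact: cphi.
Qed.

(** The inner integral is the difference of [f] between the ends of a vertical chord. Under x = cos
    t, its upper and lower terms become the integrals over the two half circles. *)
Lemma green_vertical :
  (\int[mu]_x \int[mu]_y ((g \_ pdisc) (x, y))%:E =
   (\int[mu]_(t in `[- pi, pi]) (f (cos t, sin t) * sin t))%:E)%E.
Proof.
have n11 : (-1 : R) < 1 by lra.
have pi0 := pi_gt0 R.
have -> : (fun x : R => (\int[mu]_y ((g \_ pdisc) (x, y))%:E)%E) =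
    ((fun x : R => (b1 x - b2 x)%:E) \_ `]-1, 1[).
  apply/funext => x; rewrite patchE mem_setE; case: ifPn => x1; first exact: section_integral.
  by rewrite integral0_eq// => y _; rewrite patchE (negbTE (section_empty y x1)).
rewrite -integral_mkcond.
have cb : {in `[-1, 1], continuous (fun x => b1 x - b2 x)}.
  by move=> x x1; apply: continuousB; [exact: cb1|exact: cb2].
rewrite (oo_integral cb); congr (_%:E).
have [P1 dP1] := within_primitive n11 (in_within cb1).
have [P2 dP2] := within_primitive n11 (in_within cb2).
rewrite (Rint_FTC (F := fun x => P1 x - P2 x) n11 (in_within cb)); last first.
  by move=> x x1; exact: is_deriveB (dP1 x x1) (dP2 x x1).
have up : \int[mu]_(t in `[0, pi]) phi t = P1 1 - P1 (- 1).
  rewrite (half_circle pi0 dP1) ?cos0 ?cospi// => t; rewrite in_itv/= => t0.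
  by rewrite /b1 s_cos ger0_norm// sin_ge0_pi.
have down : \int[mu]_(t in `[- pi, 0]) phi t = P2 (- 1) - P2 1.
  have pi0' : - pi < 0 :> R by rewrite oppr_lt0.
  rewrite (half_circle pi0' dP2) ?cosN ?cos0 ?cospi// => t; rewrite in_itv/= => /andP[t1 t2].
  have st : sin t <= 0.
    by rewrite -[t]opprK sinN oppr_le0 sin_ge0_pi//; apply/andP; split; lra.
  by rewrite /b2 s_cos ler0_norm// opprK.
have cphi' (u v : R) : {within `[u, v], continuous phi} by apply: in_within => t _; exact: cphi.
(* One primitive on the whole period glues the two half circles together. *)
have [Q dQ] := within_primitive pi2_gt0 (cphi' (- pi) pi).
have QE (u v : R) : u < v -> - pi <= u -> v <= pi -> \int[mu]_(t in `[u, v]) phi t = Q v - Q u.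
  move=> uv u1 v1; apply: (Rint_FTC uv (cphi' u v)) => t; rewrite in_itv/= => /andP[ut tv].
  by apply: dQ; rewrite in_itv/= (le_trans u1 ut) (le_trans tv v1).
rewrite QE ?lexx//; last exact: pi2_gt0.
move: up down; rewrite !QE ?lexx ?oppr_lt0 ?oppr_le0 ?(ltW pi0)//; lra.
Qed.

End VerticalDerivative.
End Green.

(** * From area integrals to circle integrals, real case *)

Section AreaIntegral.
Context {R : realType}.
Local Notation mu := (@lebesgue_measure R).
Local Notation pl := (measurableTypeR R * measurableTypeR R)%type.
Local Notation leb2 := (mu \x mu)%E.

(** Exchanging the coordinates of the plane replaces [t] by pi/2 - t on the circle; periodicity
    makes this harmless. *)
Lemma circle_shift (g : R -> R) : continuous g -> (forall t, g (t + pi * 2) = g t) ->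
  \int[mu]_(t in `[- pi, pi]) g (pi / 2 - t) = \int[mu]_(t in `[- pi, pi]) g t.
Proof.
move=> cg pg; have pi0 := pi_gt0 R.
have cw (a b : R) : {within `[a, b], continuous g} by exact: continuous_subspaceT.
have ab : - (pi * 2) < pi * 2 :> R by rewrite gtrN// mulr_gt0.
have [Q dQ] := within_primitive ab (cw _ _).
(* The reflected window is [-pi/2, 3 pi/2]; by periodicity Q(t + 2 pi) - Q(t) is constant, so both
   windows give the same integral. *)
have shift : Q (pi / 2 + pi) - Q (- (pi / 2)) = Q pi - Q (- pi).
  have lt1 : - pi < - (pi / 2) :> R by lra.
  have c0 : {within `[- pi, - (pi / 2)], continuous (fun _ : R => 0 : R)}.
    by apply: in_within => t _; exact: cst_continuous.
  have d0 : {in `[- pi, - (pi / 2)], forall t : R,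
      is_derive t 1 (fun t => Q (t + pi * 2) - Q t) ((fun=> 0 : R) t)}.
    move=> t; rewrite in_itv/= => /andP[t1 t2].
    have ds : is_derive t 1 (fun t : R => t + pi * 2) (1 : R).
      have h := is_deriveD (is_derive_id t (1 : R)) (is_derive_cst (pi * 2 : R) t 1).
      by apply: (is_derive_eq h); rewrite addr0.
    have i1 : t + pi * 2 \in `[- (pi * 2), pi * 2] by rewrite in_itv/=; lra.
    have i2 : t \in `[- (pi * 2), pi * 2] by rewrite in_itv/=; lra.
    have h := is_deriveB (@is_derive1_comp _ Q (fun t => t + pi * 2) t _ _ (dQ _ i1) ds) (dQ _ i2).
    by apply: (is_derive_eq h); rewrite mulr1 pg subrr.
  have := Rint_FTC lt1 c0 d0.
  have c0' : {within `[- pi, - (pi / 2)], continuous (fun _ : R => 0 : R)} by exact: c0.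
  have e0 : {in `[- pi, - (pi / 2)], forall t : R, is_derive t 1 (fun _ : R => 0 : R) ((fun=> 0 : R) t)}.
    by move=> t _; exact: is_derive_cst.
  rewrite (Rint_FTC lt1 c0' e0) subrr.
  have -> : - (pi / 2) + pi * 2 = pi / 2 + pi :> R by field.
  have -> : - pi + pi * 2 = pi :> R by ring.
  by lra.
rewrite (Rint_FTC pi2_gt0 (cw _ _) (F := Q)); last first.
  by move=> t; rewrite in_itv/= => ?; apply: dQ; rewrite in_itv/=; lra.
have dr (t : R) : is_derive t 1 (fun t : R => pi / 2 - t) (-1 : R).
  have h := is_deriveB (is_derive_cst (pi / 2 : R) t 1) (is_derive_id t (1 : R)).
  by apply: (is_derive_eq h); rewrite sub0r.
have cr : continuous (fun t : R => g (pi / 2 - t)).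
  move=> t; have c1 : {for t, continuous (fun t : R => pi / 2 - t)}.
    by apply: differentiable_continuous; apply/derivable1_diffP.
  exact: (cvg_comp _ _ c1 (cg _)).
rewrite (Rint_FTC pi2_gt0 (continuous_subspaceT cr) (F := fun t => - Q (pi / 2 - t))).
  rewrite !opprK; have -> : pi / 2 - pi = - (pi / 2) :> R by field.
  by lra.
move=> t; rewrite in_itv/= => /andP[t1 t2].
have i1 : pi / 2 - t \in `[- (pi * 2), pi * 2] by rewrite in_itv/=; lra.
have h := is_deriveN (@is_derive1_comp _ Q (fun t => pi / 2 - t) t _ _ (dQ _ i1) (dr t)).
by apply: (is_derive_eq h); rewrite mulrN1 opprK.
Qed.

Lemma pnorm_pdisc (p : R * R) : pdisc p -> pnorm p < 1.
Proof. by rewrite /pdisc unit_discE. Qed.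

Section Iterated.
Variables (g : R * R -> R) (M : R).
Hypothesis cg : forall p, pdisc p -> {for p, continuous g}.
Hypothesis gM : forall p, pdisc p -> `|g p| <= M.

Let ig : leb2.-integrable setT (EFin \o ((g : pl -> R) \_ (pdisc : set pl))).
Proof.
rewrite -restrict_EFin; apply/(integrable_mkcond _ measurable_pdisc).
exact: pdisc_integrable cg gM.
Qed.

Let intE : (\int[leb2]_(p in (pdisc : set pl)) g p)%R =
  fine (\int[leb2]_p (((g : pl -> R) \_ (pdisc : set pl)) p)%:E)%E.
Proof. by rewrite /Rintegral integral_mkcond restrict_EFin. Qed.

Lemma iterated_yx : (\int[leb2]_(p in (pdisc : set pl)) g p)%R =
  fine (\int[mu]_x \int[mu]_y ((g \_ pdisc) (x, y))%:E)%E.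
Proof. by rewrite intE -(integral12_prod_meas1 ig). Qed.

Lemma iterated_xy : (\int[leb2]_(p in (pdisc : set pl)) g p)%R =
  fine (\int[mu]_y \int[mu]_x ((g \_ pdisc) (x, y))%:E)%E.
Proof. by rewrite intE -(integral21_prod_meas1 ig). Qed.

End Iterated.

Section RealGreen.
Variables (r M : R) (f g : R * R -> R).
Hypothesis r1 : 1 < r.
Hypothesis cf : forall p, pnorm p < r -> {for p, continuous f}.
Hypothesis cg : forall p, pnorm p < r -> {for p, continuous g}.
Hypothesis gM : forall p, pdisc p -> `|g p| <= M.

Let cgD p : pdisc p -> {for p, continuous g}.
Proof. by move=> /pnorm_pdisc p1; apply: cg; exact: lt_trans r1. Qed.

Lemma area_vertical :
  (forall x y, pnorm (x, y) < r -> is_derive y 1 (fun y => f (x, y)) (g (x, y))) ->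
  (\int[leb2]_(p in (pdisc : set pl)) g p)%R =
  \int[mu]_(t in `[- pi, pi]) (f (cos t, sin t) * sin t).
Proof. by move=> df; rewrite (iterated_yx cgD gM) (green_vertical r1 cf cg df). Qed.

Let cswap (h : R * R -> R) : (forall p, pnorm p < r -> {for p, continuous h}) ->
  forall p, pnorm p < r -> {for p, continuous (fun p => h (p.2, p.1))}.
Proof.
move=> ch [x y]; rewrite pnorm_swap => /ch cp.
have l : (fun p : R * R => (p.2, p.1)) @ (x, y) --> (y, x).
  have l1 : (fun p : R * R => p.2) @ (x, y) --> y by exact: cvg_snd.
  have l2 : (fun p : R * R => p.1) @ (x, y) --> x by exact: cvg_fst.
  exact: (cvg_pair l1 l2).
exact: (cvg_comp _ _ l cp).
Qed.

(** The vertical case reflected in the diagonal, which preserves the disc; [circle_shift] then turns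
    sin back into cos. *)
Lemma area_horizontal :
  (forall x y, pnorm (x, y) < r -> is_derive x 1 (fun x => f (x, y)) (g (x, y))) ->
  (\int[leb2]_(p in (pdisc : set pl)) g p)%R =
  \int[mu]_(t in `[- pi, pi]) (f (cos t, sin t) * cos t).
Proof.
move=> df; rewrite (iterated_xy cgD gM).
pose f' (p : R * R) := f (p.2, p.1); pose g' (p : R * R) := g (p.2, p.1).
have df' x y : pnorm (x, y) < r -> is_derive y 1 (fun y => f' (x, y)) (g' (x, y)).
  by rewrite pnorm_swap => /df.
have -> : (fun y => \int[mu]_x ((g \_ pdisc) (x, y))%:E)%E =
    (fun x => \int[mu]_y ((g' \_ pdisc) (x, y))%:E)%E.
  apply/funext => y; apply: eq_integral => x _; congr (_%:E).
  rewrite !patchE /g'/=; have -> // : ((x, y) \in pdisc) = ((y, x) \in pdisc).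
  by apply/idP/idP => /set_mem/pdisc_swap/mem_set.
rewrite (green_vertical r1 (cswap cf) (cswap cg) df') /f'/=.
pose h (t : R) := f (cos t, sin t) * cos t.
have ch : continuous h.
  move=> t; have l : (fun t : R => (cos t, sin t)) @ t --> (cos t, sin t).
    by apply: cvg_pairR; [exact: continuous_cos|exact: continuous_sin].
  apply: continuousM; last exact: continuous_cos.
  apply: (cvg_comp _ _ l); apply: cf; apply: le_lt_trans r1; apply: pnorm_le1.
  by rewrite cos2Dsin2.
rewrite -(@circle_shift h ch); last by move=> t; rewrite /h mulr_natr cosD2pi sinD2pi.
apply: eq_Rintegral => t _; rewrite /h.
by rewrite cosB sinB cos_pihalf sin_pihalf !mul0r !mul1r add0r subr0.
Qed.

End RealGreen.
End AreaIntegral.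

(** Positive and negative parts are scaled separately; integrability keeps both finite, so [fine]
    respects their difference. *)
Lemma Rintegral_mscale d (T : measurableType d) (R : realType)
    (m : {measure set T -> \bar R}) (k : {nonneg R}) (D : set T) (f : T -> R) :
  measurable D -> m.-integrable D (EFin \o f) ->
  (\int[mscale k m]_(x in D) f x)%R = k%:num * (\int[m]_(x in D) f x)%R.
Proof.
move=> mD fi; have ip := integrable_funepos mD fi; have im := integrable_funeneg mD fi.
have fp := integrable_fin_num mD ip; have fm := integrable_fin_num mD im.
rewrite /Rintegral integralE [in RHS]integralE.
rewrite (ge0_integral_mscale _ mD k (measurable_int _ ip)); last by move=> x _; exact: funepos_ge0.
rewrite (ge0_integral_mscale _ mD k (measurable_int _ im)); last by move=> x _; exact: funeneg_ge0.
by rewrite -(fineK fp) -(fineK fm) -!EFinM -!EFinB /= mulrBr.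
Qed.

(** * Green's formula for complex integrands *)

Section ComplexAreaIntegral.
Context {R : realType}.
Local Notation C := (R[i]^o).
Local Notation mu := (@lebesgue_measure R).
Local Notation pl := (measurableTypeR R * measurableTypeR R)%type.
Local Notation leb2 := (mu \x mu)%E.
Variable r : R.
Hypothesis r1 : 1 < r.

(** Continuity beyond the closed disc (r > 1): by compactness it yields boundedness, hence
    integrability, on the disc. *)
Definition pcont (f : R * R -> C) := forall p : R * R, pnorm p < r -> {for p, continuous f}.

Lemma pcontD f g : pcont f -> pcont g -> pcont (fun p => f p + g p).
Proof. by move=> cf cg p pr; apply: ccvgD; [exact: cf|exact: cg]. Qed.

Lemma pcontM f g : pcont f -> pcont g -> pcont (fun p => f p * g p).
Proof. by move=> cf cg p pr; apply: ccvgM; [exact: cf|exact: cg]. Qed.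

Lemma pcontZ (c : C) f : pcont f -> pcont (fun p => c * f p).
Proof. by move=> cf p pr; apply: ccvgM; [exact: cst_continuous|exact: cf]. Qed.

Lemma pcont_cplx (f : C -> C) : fcont r f -> pcont (fun p => f (cplx p)).
Proof. by move=> cf p pr; exact: (cvg_comp _ _ (@continuous_cplx R p) (cf _ pr)). Qed.

Lemma normc_conjc (z : R[i]) : normc z^*%C = normc z.
Proof. by case: z => a b /=; rewrite sqrrN. Qed.

Lemma pcont_conj (f : C -> C) : fcont r f -> pcont (fun p => f (cplx p)^*%C).
Proof.
move=> cf p pr; have l := cvg_comp _ _ (@continuous_cplx R p) (@continuous_conjc R (cplx p)).
by apply: (cvg_comp _ _ l); apply: cf; rewrite normc_conjc.
Qed.

Lemma pcont_bounded f : pcont f -> exists M : R, forall p, pdisc p -> normc (f p) <= M.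
Proof.
move=> cf; pose g (z : C) := normc (f (Re z, Im z)).
have cK : {within [set z : C | normc z <= 1], continuous g}.
  apply: continuous_in_subspaceT => z /set_mem/= z1.
  have l1 : (fun z : C => Re z) @ z --> Re z by exact: continuous_Re.
  have l2 : (fun z : C => Im z) @ z --> Im z by exact: continuous_Im.
  have l : (fun z : C => (Re z, Im z)) @ z --> (Re z, Im z) by exact: (cvg_pair l1 l2).
  have zr : pnorm (Re z, Im z) < r by apply: le_lt_trans r1; case: z z1 {l1 l2 l}.
  have l3 := cvg_comp _ _ l (cf _ zr).
  exact: (cvg_comp _ _ l3 (@continuous_normc R _)).
have K0 : [set z : C | normc z <= 1] !=set0.
  by exists 0; suff : normc (0 : R[i]) <= 1 by []; rewrite normc0.
have [c _ hc] := compact_EVT_max K0 (@compact_cdisc R) cK.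
exists (g c) => -[x y] xy; apply: (hc (x +i* y)); apply/mem_set; apply: ltW.
exact: (pnorm_pdisc xy).
Qed.

Lemma pcont_pdisc f : pcont f -> forall p, pdisc p -> {for p, continuous f}.
Proof. by move=> cf p /pnorm_pdisc p1; apply: cf; exact: lt_trans r1. Qed.

Lemma cont_ReC (f : R * R -> C) p : {for p, continuous f} -> {for p, continuous (fun p => Re (f p))}.
Proof. by move=> cf; exact: (cvg_comp _ _ cf (@continuous_Re R _)). Qed.

Lemma cont_ImC (f : R * R -> C) p : {for p, continuous f} -> {for p, continuous (fun p => Im (f p))}.
Proof. by move=> cf; exact: (cvg_comp _ _ cf (@continuous_Im R _)). Qed.

Lemma pcont_Re_integrable f : pcont f ->
  leb2.-integrable (pdisc : set pl) (EFin \o ((fun p => Re (f p)) : pl -> R)).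
Proof.
move=> cf; have [M fM] := pcont_bounded cf.
apply: (@pdisc_integrable _ _ M) => p pD; first exact: cont_ReC (pcont_pdisc cf pD).
exact: le_trans (ler_Re_normc _) (fM p pD).
Qed.

Lemma pcont_Im_integrable f : pcont f ->
  leb2.-integrable (pdisc : set pl) (EFin \o ((fun p => Im (f p)) : pl -> R)).
Proof.
move=> cf; have [M fM] := pcont_bounded cf.
apply: (@pdisc_integrable _ _ M) => p pD; first exact: cont_ImC (pcont_pdisc cf pD).
exact: le_trans (ler_Im_normc _) (fM p pD).
Qed.

Definition aint (f : R * R -> C) : C := complex_integral leb2 (pdisc : set pl) (f : pl -> C).

Lemma Re_aint f : Re (aint f) = (\int[leb2]_(p in (pdisc : set pl)) Re (f p))%R.
Proof. by []. Qed.

Lemma Im_aint f : Im (aint f) = (\int[leb2]_(p in (pdisc : set pl)) Im (f p))%R.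
Proof. by []. Qed.

Lemma aintD f g : pcont f -> pcont g -> aint (fun p => f p + g p) = aint f + aint g.
Proof.
move=> cf cg; apply: complex_eq; rewrite raddfD/= -RintegralD.
- by apply: eq_Rintegral => p _; rewrite raddfD.
- exact: measurable_pdisc.
- exact: pcont_Re_integrable.
- exact: pcont_Re_integrable.
- by apply: eq_Rintegral => p _; rewrite raddfD.
- exact: measurable_pdisc.
- exact: pcont_Im_integrable.
- exact: pcont_Im_integrable.
Qed.

Lemma aintZ c f : pcont f -> aint (fun p => c * f p) = c * aint f.
Proof.
move=> cf.
have ir := pcont_Re_integrable cf.
have ii := pcont_Im_integrable cf.
have mD : measurable (pdisc : set pl) := measurable_pdisc.
have iZ (k : R) (h : pl -> R) : leb2.-integrable (pdisc : set pl) (EFin \o h) ->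
    leb2.-integrable (pdisc : set pl) (EFin \o (fun x => k * h x)).
  move=> ih; rewrite (_ : _ \o _ = (fun x => k%:E * (EFin \o h) x)%E)//.
  exact: integrableZl.
apply: complex_eq; rewrite ?Re_mulc ?Im_mulc !Re_aint !Im_aint.
  rewrite -(RintegralZl (Re c) mD ir) -(RintegralZl (Im c) mD ii).
  rewrite -(RintegralB mD (iZ _ _ ir) (iZ _ _ ii)).
  by apply: eq_Rintegral => x _; rewrite Re_mulc.
rewrite -(RintegralZl (Re c) mD ii) -(RintegralZl (Im c) mD ir).
rewrite -(RintegralD mD (iZ _ _ ii) (iZ _ _ ir)).
by apply: eq_Rintegral => x _; rewrite Im_mulc.
Qed.

Lemma aint_vertical f g : pcont f -> pcont g ->
  (forall x y, pnorm (x, y) < r -> rder (fun y => f (x, y)) y (g (x, y))) ->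
  aint g = cint (- pi) pi (fun t => f (cos t, sin t) * (sin t)%:C).
Proof.
move=> cf cg df; have [M gM] := pcont_bounded cg.
apply: complex_eq; rewrite ?Re_aint ?Im_aint ?Re_cint ?Im_cint.
  rewrite (@area_vertical _ r M (fun p => Re (f p)) (fun p => Re (g p)) r1
    (fun p pr => cont_ReC (cf p pr)) (fun p pr => cont_ReC (cg p pr))
    (fun p pD => le_trans (ler_Re_normc _) (gM p pD)) (fun x y xy => (df x y xy).1)).
  by apply: eq_Rintegral => t _; rewrite Re_mulc/= mulr0 subr0.
rewrite (@area_vertical _ r M (fun p => Im (f p)) (fun p => Im (g p)) r1
  (fun p pr => cont_ImC (cf p pr)) (fun p pr => cont_ImC (cg p pr))
  (fun p pD => le_trans (ler_Im_normc _) (gM p pD)) (fun x y xy => (df x y xy).2)).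
by apply: eq_Rintegral => t _; rewrite Im_mulc/= mulr0 add0r.
Qed.

Lemma aint_horizontal f g : pcont f -> pcont g ->
  (forall x y, pnorm (x, y) < r -> rder (fun x => f (x, y)) x (g (x, y))) ->
  aint g = cint (- pi) pi (fun t => f (cos t, sin t) * (cos t)%:C).
Proof.
move=> cf cg df; have [M gM] := pcont_bounded cg.
apply: complex_eq; rewrite ?Re_aint ?Im_aint ?Re_cint ?Im_cint.
  rewrite (@area_horizontal _ r M (fun p => Re (f p)) (fun p => Re (g p)) r1
    (fun p pr => cont_ReC (cf p pr)) (fun p pr => cont_ReC (cg p pr))
    (fun p pD => le_trans (ler_Re_normc _) (gM p pD)) (fun x y xy => (df x y xy).1)).
  by apply: eq_Rintegral => t _; rewrite Re_mulc/= mulr0 subr0.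
rewrite (@area_horizontal _ r M (fun p => Im (f p)) (fun p => Im (g p)) r1
  (fun p pr => cont_ImC (cf p pr)) (fun p pr => cont_ImC (cg p pr))
  (fun p pD => le_trans (ler_Im_normc _) (gM p pD)) (fun x y xy => (df x y xy).2)).
by apply: eq_Rintegral => t _; rewrite Im_mulc/= mulr0 add0r.
Qed.

Lemma conj_circ (t : R) : (circ t)^*%C * circ t = 1.
Proof.
apply: complex_eq => /=; last by ring.
by rewrite -(cos2Dsin2 t); ring.
Qed.

Lemma fcont_in_cont_circ (f : C -> C) a b : fcont r f -> in_cont a b (fun t => f (circ t)).
Proof.
move=> cf t _; have tr : normc (circ t : C) < r by rewrite normc_circ.
exact: (cvg_comp _ _ (@cont_circ R t) (cf _ tr)).
Qed.

Lemma fcont_in_cont_conj_circ (f : C -> C) a b : fcont r f ->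
  in_cont a b (fun t => f (circ t)^*%C).
Proof.
move=> cf t _; have l := cvg_comp _ _ (@cont_circ R t) (@continuous_conjc R (circ t)).
have tr : normc ((circ t)^*%C : C) < r by rewrite normc_conjc normc_circ.
exact: (cvg_comp _ _ l (cf _ tr)).
Qed.

(** The integrand is the Wirtinger derivative (d/dx + i d/dy) / 2 of h(w) k(conj w): the terms with
    [h'] cancel. The two real Green formulas contribute cos t and i sin t, which add up to
    [circ t]. *)
Lemma green_antiholomorphic (h h' k k' : C -> C) :
  (forall w : C, normc w < r -> is_derive w 1 h (h' w)) ->
  (forall w : C, normc w < r -> is_derive w 1 k (k' w)) ->
  fcont r h' -> fcont r k' ->
  aint (fun p => h (cplx p) * k' (cplx p)^*%C) =
  2^-1 * cint (- pi) pi (fun t => h (circ t) * k (circ t)^*%C * circ t).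
Proof.
move=> dh dk ch' ck'.
have ch : fcont r h by move=> w wr; exact: cder_cont (dh w wr).
have ck : fcont r k by move=> w wr; exact: cder_cont (dk w wr).
pose phi (p : R * R) : C := h (cplx p) * k (cplx p)^*%C.
pose phix (p : R * R) : C := h' (cplx p) * k (cplx p)^*%C + h (cplx p) * k' (cplx p)^*%C.
pose phiy (p : R * R) : C := ('i%C : C) * (h' (cplx p) * k (cplx p)^*%C) +
   (- 'i%C : C) * (h (cplx p) * k' (cplx p)^*%C).
have c1 := pcont_cplx ch; have c2 := pcont_conj ck.
have c3 := pcont_cplx ch'; have c4 := pcont_conj ck'.
have cphi : pcont phi by exact: (pcontM c1 c2).
have cphix : pcont phix by exact: (pcontD (pcontM c3 c2) (pcontM c1 c4)).
have cphiy : pcont phiy.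
  have a1 : pcont (fun p => ('i%C : C) * (h' (cplx p) * k (cplx p)^*%C)).
    exact: (pcontZ (pcontM c3 c2)).
  have a2 : pcont (fun p => (- 'i%C : C) * (h (cplx p) * k' (cplx p)^*%C)).
    exact: (pcontZ (pcontM c1 c4)).
  exact: (pcontD a1 a2).
have dx x y : pnorm (x, y) < r -> rder (fun x => phi (x, y)) x (phix (x, y)).
  move=> xy; have xy' : normc ((x +i* y)^*%C : C) < r by rewrite normc_conjc.
  have d1 : rder (fun x => x +i* y : C) x 1 by split; [exact: is_derive_id|exact: is_derive_cst].
  have d2 : rder (fun x => (x +i* y)^*%C : C) x 1.
    by split; [exact: is_derive_id|exact: is_derive_cst].
  apply: (rder_eq (rderM (rder_comp d1 (dh _ xy)) (rder_comp d2 (dk _ xy')))).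
  by rewrite !mulr1.
have dy x y : pnorm (x, y) < r -> rder (fun y => phi (x, y)) y (phiy (x, y)).
  move=> xy; have xy' : normc ((x +i* y)^*%C : C) < r by rewrite normc_conjc.
  have d1 : rder (fun y => x +i* y : C) y 'i%C.
    by split; [exact: is_derive_cst|exact: is_derive_id].
  have d2 : rder (fun y => (x +i* y)^*%C : C) y (- 'i%C).
    split; first by rewrite /= oppr0; exact: is_derive_cst.
    exact: is_deriveN (is_derive_id y (1 : R)).
  apply: (rder_eq (rderM (rder_comp d1 (dh _ xy)) (rder_comp d2 (dk _ xy')))).
  by rewrite /phiy /cplx /=; ring.
have i2 : 'i%C * 'i%C = -1 :> R[i] by rewrite -expr2 sqr_i.
have -> : (fun p => h (cplx p) * k' (cplx p)^*%C) = (fun p => (2^-1 : C) * (phix p + ('i%C : C) * phiy p)).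
  apply/funext => p; rewrite /phix /phiy.
  set A := h' _ * _; set B := h _ * _.
  have -> : 'i%C * ('i%C * A + - 'i%C * B) = ('i%C * 'i%C) * (A - B) :> R[i] by ring.
  by rewrite i2; field.
have ciy : pcont (fun p => ('i%C : C) * phiy p) by exact: (pcontZ cphiy).
rewrite (aintZ _ (pcontD cphix ciy)) (aintD cphix ciy) (aintZ _ cphiy); congr (_ * _).
rewrite (aint_horizontal cphi cphix dx) (aint_vertical cphi cphiy dy).
have cphic : in_cont (- pi) pi (fun t => phi (cos t, sin t)).
  exact: in_contM (fcont_in_cont_circ ch) (fcont_in_cont_conj_circ ck).
have ccos : in_cont (- pi) pi (fun t : R => (cos t)%:C : C).
  by move=> t _; exact: (cvg_comp _ _ (@continuous_cos R t) (@continuous_real_complex R _)).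
have csin : in_cont (- pi) pi (fun t : R => (sin t)%:C : C).
  by move=> t _; exact: (cvg_comp _ _ (@continuous_sin R t) (@continuous_real_complex R _)).
have c5 := in_contM cphic ccos; have c6 := in_contM cphic csin.
rewrite -(cintZ _ c6) -(cintD c5 (in_contM (@in_cont_cst _ _ _ 'i%C) c6)).
apply: eq_cint => t _.
have -> : h (circ t) * k (circ t)^*%C * circ t =
    h (circ t) * k (circ t)^*%C * ((cos t)%:C + 'i%C * (sin t)%:C) by rewrite -(complexE (circ t)).
by rewrite [RHS]mulrDr; congr (_ + _); exact: mulrCA.
Qed.

Lemma area_integralE (f : R[i] -> R[i]) : pcont (fun p => f (cplx p)) ->
  area_integral f = (pi^-1)%:C * aint (fun p => f (cplx p)).
Proof.
move=> cf.
have E (g : pl -> R) : leb2.-integrable (pdisc : set pl) (EFin \o g) ->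
    (\int[@dA R]_(p in pdisc) g p)%R = pi^-1 * (\int[leb2]_(p in (pdisc : set pl)) g p)%R.
  by move=> ig; rewrite /dA (Rintegral_mscale _ measurable_pdisc ig).
apply: complex_eq; rewrite ?Re_mulc ?Im_mulc/= ?mul0r ?subr0 ?addr0.
  exact: E (pcont_Re_integrable cf).
exact: E (pcont_Im_integrable cf).
Qed.

End ComplexAreaIntegral.

(** * The eigenfunction *)

Section Hinfty_bergman.
Context {R : realType}.
Local Notation C := (R[i]^o).
Local Notation pl := (measurableTypeR R * measurableTypeR R)%type.
Local Notation leb2 := (@lebesgue_measure R \x @lebesgue_measure R)%E.

(** A bounded function is square-integrable because the disc has finite area; measurability comes
    from continuity. *)
Lemma Hinfty_sub_bergman : @Hinfty R `<=` @bergman_space R.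
Proof.
move=> f [df [M fM]]; split=> //.
have cf (p : R * R) : pdisc p -> {for p, continuous (fun p => f (cplx p) : C)}.
  move=> pD; have c : {for (cplx p : C), continuous (f : C -> C)}.
    by apply: differentiable_continuous; apply/derivable1_diffP; exact: df.
  exact: (cvg_comp _ _ (@continuous_cplx R p) c).
split.
- by apply: cont_measurable_prod open_pdisc _ => p pD; exact: cont_ReC (cf p pD).
- by apply: cont_measurable_prod open_pdisc _ => p pD; exact: cont_ImC (cf p pD).
have E (p : pl) : Re (`|f (cplx p)| ^+ 2) = normc (f (cplx p)) ^+ 2.
  by rewrite normrE_normc -rmorphXn.
have i1 : leb2.-integrable (pdisc : set pl) (EFin \o ((fun p => normc (f (cplx p)) ^+ 2) : pl -> R)).
  apply: (@pdisc_integrable _ _ (Re M ^+ 2)) => p pD.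
    have c : {for p, continuous (fun p => normc (f (cplx p)))}.
      exact: (cvg_comp _ _ (cf p pD) (@continuous_normc R _)).
    exact: (cvg_comp _ _ c (@exprn_continuous R 2 _)).
  have := fM _ pD; rewrite normrE_normc lecE/= => /andP[_ h].
  by rewrite ger0_norm ?sqr_ge0// ler_pXn2r// ?nnegrE ?normc_ge0// (le_trans (normc_ge0 _) h).
have mD : measurable (pdisc : set pl) := measurable_pdisc.
under eq_integral do rewrite E.
rewrite /dA (ge0_integral_mscale _ mD _ (measurable_int _ i1)).
  rewrite lte_mul_pinfty ?lee_fin ?invr_pi_ge0//.
  have /integrableP[_] := i1; apply: le_lt_trans; rewrite le_eqVlt; apply/orP; left; apply/eqP.
  by apply: eq_integral => p _; rewrite /= ger0_norm ?sqr_ge0.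
by move=> p _; rewrite lee_fin sqr_ge0.
Qed.

End Hinfty_bergman.

Section Eigenfunction.
Context {R : realType}.
Local Notation C := (R[i]^o).

(** By compactness, all dilations of the closed disc with ratio close enough to 1 stay inside
    [V]. *)
Lemma disc_radius (V : set C) : open V -> (forall z : C, normc z <= 1 -> V z) ->
  exists2 r : R, 1 < r & forall z : C, normc z < r -> V z.
Proof.
move=> oV V1.
have : \forall t \near (1 : R), [set z : C | normc z <= 1] `<=` (fun z => V (t%:C * z)).
  have cover := (compact_near_coveringP _).1 (@compact_cdisc R).
  apply: (cover R (nbhs (1 : R)) (fun t z => V (t%:C * z))) => z /= z1.
  have l : (fun q : C * R => q.2%:C * q.1 : C) @ (nbhs z, nbhs (1 : R)) --> z.
    rewrite -[X in _ --> X]mul1r; apply: ccvgM.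
      exact: (cvg_comp _ _ (@cvg_snd _ _ (nbhs z) (nbhs (1 : R)) _) (@continuous_real_complex R 1)).
    exact: cvg_fst.
  apply: l; move: oV; rewrite openE; apply; exact: V1.
move=> /nbhs_ballP[e /= e0 he].
have t1 : 0 < 1 + e / 2 by rewrite addr_gt0// divr_gt0.
exists (1 + e / 2); first by rewrite ltrDl divr_gt0.
move=> z zt.
have b : ball (1 : R) e (1 + e / 2).
  by rewrite /ball/= opprD addNKr normrN ger0_norm ?(ltW (divr_gt0 e0 _))// ltr_pdivrMr// ltr_pMr// ltr1n.
have tn0 : (1 + e / 2)%:C != 0 :> R[i] by rewrite eq_complex/= eqxx andbT gt_eqF.
have := he _ b ((1 + e / 2)%:C^-1 * z); rewrite mulVKf//; apply.
suff : normc ((1 + e / 2)%:C^-1 * z) <= 1 by [].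
rewrite normcM normcV normc_real (ger0_norm (ltW t1)) [leLHS]mulrC ler_pdivrMr// mul1r.
exact: ltW.
Qed.

Lemma rder_conj (phi : R -> C) t d : rder phi t d -> rder (fun t => (phi t)^*%C : C) t (d^*%C : C).
Proof.
move=> [d1 d2].
have ReJ (z : C) : Re z^*%C = Re z by case: z.
have ImJ (z : C) : Im z^*%C = - Im z by case: z.
split; first by rewrite ReJ; under eq_fun do rewrite ReJ.
by rewrite ImJ; under eq_fun do rewrite ImJ; exact: is_deriveN.
Qed.

Section Candidate.
Variables (gamma : C) (psi : C -> C) (lambda : C) (r : R).
Hypothesis r1 : 1 < r.
Hypothesis dpsi : holo r psi.

Let q (w : C) : C := gamma + w * (psi w - lambda).

Hypothesis q0 : forall w : C, normc w < r -> q w != 0.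

Let psi' : C -> C := 'D_1 psi.
Let g (w : C) : C := (w * psi' w + 2 * (psi w - lambda)) / q w.
Let F := segint g 0.
Let f (z : C) : C := eigen_candidate gamma psi lambda z.

Let r0 : 0 < r. Proof. exact: lt_trans r1. Qed.

Let dpsiD (w : C) : normc w < r -> is_derive w 1 psi (psi' w).
Proof. by move=> wr; exact: derivableP (dpsi wr). Qed.

Let dq (w : C) : normc w < r -> is_derive w 1 q (psi w - lambda + w * psi' w).
Proof.
move=> wr.
have h := cderD (cder_cst gamma w)
  (cderM (cder_id w) (cderD (dpsiD wr) (cder_cst (- lambda) w))).
by apply: (cder_eq h); rewrite add0r mul1r addr0.
Qed.

Let dg : holo r g.
Proof.
move=> w wr.
have dpsi' : is_derive w 1 psi' ('D_1 psi' w) := derivableP (open_holo_derive dpsi wr).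
have h := cderM (cderD (cderM (cder_id w) dpsi')
  (cderZ (2 : C) (cderD (dpsiD wr) (cder_cst (- lambda) w)))) (cder_inv (q0 wr) (dq wr)).
by have [] := h.
Qed.

Let dF (w : C) : normc w < r -> is_derive w 1 F (g w).
Proof. exact: holo_primitive r0 dg w. Qed.

Let fE (z : C) : f z = complex_exp (- F z).
Proof.
rewrite /f /eigen_candidate; congr (complex_exp (- _)).
rewrite /integral_from0 /F /segint; apply: eq_cint => t _.
by rewrite add0r subr0.
Qed.

Lemma is_derive_eigen_candidate (w : C) : normc w < r -> is_derive w 1 f (- (g w * f w)).
Proof.
move=> wr.
have -> : f = (fun z => complex_exp (- F z)) by apply/funext => z; exact: fE.
have dN : is_derive w 1 (fun z => - F z : C) (- g w).
  by have h := is_deriveN (dF wr); exact: h.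
by apply: (cder_eq (cder_comp dN (is_derive_complex_exp _))); rewrite mulrN mulrC.
Qed.

Lemma eigen_candidate_neq0 z : f z != 0.
Proof. by rewrite fE -normc_gt0 normc_complex_exp expR_gt0. Qed.

Let hf : holo r f.
Proof. by move=> w wr; have [] := is_derive_eigen_candidate wr. Qed.

(** [f] is holomorphic on a disc of radius r > 1, hence bounded on the compact closed unit disc. *)
Lemma eigen_candidate_Hinfty : @Hinfty R f.
Proof.
split.
  by move=> z; rewrite unit_discE => z1; apply: hf; exact: lt_trans r1.
have [M hM] := pcont_bounded r1 (pcont_cplx (holo_fcont hf)).
exists M%:C => -[x y] xy; rewrite normrE_normc lecR.
exact: (hM (x, y)).
Qed.

(** * The eigenvalue equation at a fixed point z *)

Section Kernel.
Variables (z : C) (s : R).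
Hypothesis z1 : normc z < 1.
Hypothesis s1 : 1 < s.
Hypothesis sr : s <= r.
Hypothesis sz : s * normc z < 1.

(** The role of [s]: on the disc of radius [s] the kernel has no singularity. *)
Let den_neq0 (u : C) : normc u < s -> 1 - u * z != 0.
Proof.
move=> us; rewrite subr_eq0; apply/eqP => e.
have : normc (u * z) < 1.
  rewrite normcM; apply: le_lt_trans sz; apply: ler_wpM2r; first exact: normc_ge0.
  exact: ltW.
by rewrite -e normc1 ltxx.
Qed.

Let kappa (u : C) : C := ((1 - u * z) ^+ 2)^-1.
Let kappa1 (u : C) : C := u / (1 - u * z).
(** Given as an integral because the closed form u / z + log(1 - u z) / z^2 breaks down at z = 0. *)
Let m (u : C) : C := - segint kappa1 0 u.
(** A primitive of u kappa(u), found by parts. It is needed because conj w in the symbol multiplies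
    the kernel, itself a function of conj w. *)
Let K (u : C) : C := m u + u * kappa1 u.

Let s0 : 0 < s. Proof. exact: lt_trans s1. Qed.

Let dden (u : C) : is_derive u 1 (fun u => 1 - u * z : C) (- z).
Proof.
have -> : (fun u => 1 - u * z : C) = (fun u => 1 + (- z) * u : C).
  by apply/funext => v; rewrite mulNr (mulrC z).
by apply: (cder_eq (cderD (cder_cst 1 u) (cderZ (- z) (cder_id u)))); rewrite add0r mulr1.
Qed.

Let dkappa1 (u : C) : normc u < s -> is_derive u 1 kappa1 (kappa u).
Proof.
move=> us.
have dinv : is_derive u 1 (fun u => (1 - u * z)^-1 : C) (- (- z) / (1 - u * z) ^+ 2).
  exact: (@cder_inv _ (fun u => 1 - u * z) u _ (den_neq0 us) (dden u)).
apply: (cder_eq (cderM (cder_id u) dinv)).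
by rewrite /kappa; field; exact: den_neq0.
Qed.

Let hkappa1 : holo s kappa1.
Proof. by move=> u us; have [] := dkappa1 us. Qed.

Let dm (u : C) : normc u < s -> is_derive u 1 m (- kappa1 u).
Proof. by move=> us; have h := is_deriveN (holo_primitive s0 hkappa1 us); exact: h. Qed.

Let dK (u : C) : normc u < s -> is_derive u 1 K (u * kappa u).
Proof.
move=> us; apply: (cder_eq (cderD (dm us) (cderM (cder_id u) (dkappa1 us)))).
by rewrite mul1r addrA addNr add0r.
Qed.

Let ckappa : fcont s kappa.
Proof.
move=> u us; have n0 : (1 - u * z) ^+ 2 != 0 by rewrite expf_neq0// den_neq0.
have c2 : {for u, continuous (fun u : C => (1 - u * z) ^+ 2 : C)}.
  exact: (@ccvgX R C (nbhs u) _ (fun u => 1 - u * z) _ 2 (cder_cont (dden u))).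
exact: (ccvgV n0 c2).
Qed.

Let ckappau : fcont s (fun u => u * kappa u).
Proof. by move=> u us; exact: (ccvgM (cder_cont (cder_id u)) (ckappa us)). Qed.

Let srw (w : C) : normc w < s -> normc w < r.
Proof. by move=> ws; exact: lt_le_trans sr. Qed.

Let df (w : C) : normc w < s -> is_derive w 1 f (- (g w * f w)).
Proof. by move=> /srw; exact: is_derive_eigen_candidate. Qed.

Let cf : fcont s f.
Proof. by move=> w ws; exact: cder_cont (df ws). Qed.

Let cpsi : fcont s psi.
Proof. by move=> w /srw wr; exact: cder_cont (dpsiD wr). Qed.

Let cK : fcont s K.
Proof. by move=> w ws; exact: cder_cont (dK ws). Qed.

Let ckappa1 : fcont s kappa1.
Proof. exact: holo_fcont hkappa1. Qed.

(** [A] and [B] are the boundary integrands for the parts gamma conj w (without its gamma) and psi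
    of the symbol; [D] is the one representing f(z), see [cint_D]. *)
Let A (t : R) : C := f (circ t) * K (circ t)^*%C * circ t.
Let B (t : R) : C := psi (circ t) * f (circ t) * kappa1 (circ t)^*%C * circ t.
Let D (t : R) : C := f (circ t) * kappa1 (circ t)^*%C * circ t.

Let cA a b : in_cont a b A.
Proof.
exact: (in_contM (in_contM (fcont_in_cont_circ s1 cf) (fcont_in_cont_conj_circ s1 cK))
  (@in_cont_circ _ a b)).
Qed.

Let cB a b : in_cont a b B.
Proof.
exact: (in_contM (in_contM (in_contM (fcont_in_cont_circ s1 cpsi) (fcont_in_cont_circ s1 cf))
  (fcont_in_cont_conj_circ s1 ckappa1)) (@in_cont_circ _ a b)).
Qed.

Let cD a b : in_cont a b D.
Proof.
exact: (in_contM (in_contM (fcont_in_cont_circ s1 cf) (fcont_in_cont_conj_circ s1 ckappa1))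
  (@in_cont_circ _ a b)).
Qed.

Let cABD a b : in_cont a b (fun t => gamma * A t + B t - lambda * D t).
Proof.
have h1 : in_cont a b (fun t => gamma * A t) by apply: in_contZ; exact: cA.
have h2 : in_cont a b (fun t => lambda * D t) by apply: in_contZ; exact: cD.
exact: (in_contB (in_contD h1 (@cB a b)) h2).
Qed.

(** Product rule at e = circ t, with c = e, cj = conj e, mm = m(conj e), k = kappa1(conj e), p =
    psi(e) - lambda, p' = psi'(e), and ff, qq, gg the values of f, q, g at e. The terms in [mm] sum
    to mm c ff (qq - c p) = gamma mm c ff, since (c p' + 2 p) - (p + c p') = p; the remaining term
    is k ff qq. *)
Let boundary_algebra (i c cj mm ff qq k p p' gg : R[i]) :
  i * i = -1 -> cj * c = 1 -> qq = gamma + c * p -> gg * qq = c * p' + 2 * p ->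
  - i * ((((- k * (- i * cj)) * c + mm * (i * c)) * ff + (mm * c) * (- (gg * ff) * (i * c))) * qq
    + (mm * c * ff) * ((p + c * p') * (i * c))) =
  gamma * (ff * (mm + cj * k) * c) + p * ff * k * c.
Proof.
move=> ii cjc qE gE.
transitivity (- (i * i) * (k * (cj * c) * ff * qq + mm * c * ff * qq - mm * c * c * ff * (gg * qq)
  + mm * c * ff * c * (p + c * p'))); first by ring.
rewrite ii cjc gE qE.
transitivity (gamma * ff * mm * c + gamma * ff * k * 1 + p * ff * k * c); first by ring.
by rewrite -{1}cjc; ring.
Qed.

Let boundary_integral0 : cint (- pi) pi (fun t => gamma * A t + B t - lambda * D t) = 0.
Proof.
apply: (@cint_periodic R _
  (fun t => - 'i%C * (m (circ t)^*%C * circ t * f (circ t) * q (circ t)))); last by rewrite circ_npi.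
  (* Continuity on the degenerate interval [t, t] is continuity at [t]. *)
  by move=> t; apply: (cABD (a := t) (b := t)); rewrite bound_itvE.
move=> t.
have cs : normc (circ t : C) < s by rewrite normc_circ.
have cjs : normc ((circ t)^*%C : C) < s by rewrite normc_conjc normc_circ.
have d1 := rder_comp (rder_conj (rder_circ t)) (dm cjs).
have d2 := rder_comp (rder_circ t) (df cs).
have d3 := rder_comp (rder_circ t) (dq (srw cs)).
have cji : ('i%C * circ t)^*%C = - 'i%C * (circ t)^*%C :> R[i].
  by apply: complex_eq => /=; ring.
have ii : 'i%C * 'i%C = -1 :> R[i] by rewrite -expr2 sqr_i.
apply: (rder_eq (rderM (rder_cst (- 'i%C) t) (rderM (rderM (rderM d1 (rder_circ t)) d2) d3))).
have gq : g (circ t) * q (circ t) = circ t * psi' (circ t) + 2 * (psi (circ t) - lambda).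
  by rewrite /g divfK// q0// srw.
have H := boundary_algebra (m (circ t)^*%C) (f (circ t)) (kappa1 (circ t)^*%C) ii (conj_circ t) (erefl _) gq.
rewrite mul0r add0r cji; apply: (etrans H).
have alg (a b c d p l k : R[i]) : a * (b * c * d) + (p - l) * b * k * d =
    a * (b * c * d) + p * b * k * d - l * (b * k * d) by ring.
exact: alg.
Qed.

(** On the circle 1 - conj e z = conj e (e - z), so kappa1(conj e) e is the Cauchy kernel e / (e -
    z). *)
Let cint_D : cint (- pi) pi D = 2 * pi%:C * f z.
Proof.
rewrite -(cauchy_formula r1 z1 hf); apply: eq_cint => t _.
rewrite /D -mulrA; congr (_ * _).
have e : 1 - (circ t)^*%C * z = (circ t)^*%C * (circ t - z) by rewrite mulrBr conj_circ.
have cj0 : (circ t)^*%C != 0 :> R[i] by rewrite -normc_gt0 normc_conjc normc_circ.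
rewrite /kappa1 e; field.
by rewrite cj0 circ_sub_neq0.
Qed.

Lemma toeplitz_eigen_candidate : toeplitz (symbol gamma psi) f z = lambda * f z.
Proof.
pose I (w : R[i]) : R[i] := symbol gamma psi w * f w / (1 - w^*%C * z) ^+ 2.
pose f' (w : C) : C := - (g w * f w).
pose h (w : C) : C := psi w * f w.
pose h' (w : C) : C := psi' w * f w + psi w * f' w.
have cf' : fcont s f'.
  move=> w ws; exact: (ccvgN (ccvgM (holo_fcont dg (srw ws)) (cf ws))).
have ch' : fcont s h'.
  move=> w ws; have cpsi' := holo_fcont (open_holo_derive dpsi) (srw ws).
  exact: (ccvgD (ccvgM cpsi' (cf ws)) (ccvgM (cpsi ws) (cf' _ ws))).
have dh (w : C) : normc w < s -> is_derive w 1 h (h' w).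
  by move=> ws; exact: cderM (dpsiD (srw ws)) (df ws).
(* The factor conj w is grouped with the kernel, so this part uses the primitive [K]; the psi part
   is holomorphic times kernel and uses [kappa1]. *)
have G1 := green_antiholomorphic s1 df dK cf' ckappau.
have G2 := green_antiholomorphic s1 dh dkappa1 ch' ckappa.
have p1 := pcontM (pcont_cplx cf) (pcont_conj ckappau).
have ch : fcont s h by move=> w ws; exact: (ccvgM (cpsi ws) (cf ws)).
have p2 := pcontM (pcont_cplx ch) (pcont_conj ckappa).
have IE : (fun p : R * R => I (cplx p) : C) = (fun p => gamma * (f (cplx p) * ((cplx p)^*%C * kappa (cplx p)^*%C)) +
    h (cplx p) * kappa (cplx p)^*%C).
  by apply/funext => p; rewrite /I /symbol /h /kappa; ring.
have -> : toeplitz (symbol gamma psi) f z = area_integral I by [].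
have pI : pcont s (fun p => I (cplx p)).
  rewrite IE; exact: (pcontD (pcontZ p1) p2).
rewrite (area_integralE s1 pI) IE (aintD s1 (pcontZ p1) p2) (aintZ s1 _ p1) G1 G2.
have := boundary_integral0.
have h1 : in_cont (- pi) pi (fun t => gamma * A t) by apply: in_contZ; exact: cA.
have h2 : in_cont (- pi) pi (fun t => lambda * D t) by apply: in_contZ; exact: cD.
have hB : in_cont (- pi) pi B by exact: cB.
rewrite (cintB (in_contD h1 hB) h2) (cintD h1 hB).
rewrite (cintZ _ (@cA (- pi) pi)) (cintZ _ (@cD (- pi) pi)) cint_D => /eqP; rewrite subr_eq0 => /eqP E.
have pin0 : pi%:C != 0 :> R[i] by rewrite eq_complex/= eqxx andbT gt_eqF// pi_gt0.
have -> : (pi^-1)%:C = pi%:C^-1 :> R[i] by rewrite fmorphV.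
transitivity (pi%:C^-1 * (2^-1 * (gamma * cint (- pi) pi A + cint (- pi) pi B))).
  by rewrite /A /B /h; ring.
(* The 1/pi of the normalized area and the 1/2 of Green's formula cancel the 2 pi of Cauchy's
   formula. *)
rewrite E; move: pin0; move: (pi%:C) => p p0.
by field.
Qed.

End Kernel.
End Candidate.
End Eigenfunction.

Lemma open_neq0 (R : realType) (U : set R[i]^o) (q : R[i]^o -> R[i]^o) : open U ->
  (forall z, U z -> {for z, continuous q}) -> open [set z | U z /\ q z != 0].
Proof.
rewrite openE => oU cq z /= [Uz qz].
have FF := nbhs_filter z; have qz0 : 0 < normc (q z) by rewrite normc_gt0.
have near_q := (cvgcP (FF := FF) q (q z)).1 (cq z Uz) _ qz0.
apply: filterS2 (oU z Uz) near_q => w Uw qw; split=> //.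
by apply/eqP => qw0; move: qw; rewrite qw0 subr0 ltxx.
Qed.

Theorem theorem2p5 (R : realType) (gamma : R[i]) (psi : R[i]^o -> R[i]^o)
    (U : set R[i]^o) (lambda : R[i]) :
  gamma != 0 ->
  open U ->
  closure (@unit_disc R) `<=` U ->
  holomorphic_on U psi ->
  ~ (assoc_mero gamma psi @` (closure (@unit_disc R) `\ 0)) lambda ->
  [/\ point_spectrum (toeplitz (symbol gamma psi)) lambda,
      eigenfunction (toeplitz (symbol gamma psi)) lambda
        (eigen_candidate gamma psi lambda),
      Hinfty (eigen_candidate gamma psi lambda) &
      @Hinfty R `<=` @bergman_space R].
Proof.
move=> gamma0 oU DU hpsi Rlambda.
pose q (w : R[i]^o) : R[i]^o := gamma + w * (psi w - lambda).
have cq z : U z -> {for z, continuous q}.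
  move=> Uz; have dz : is_derive z 1 psi ('D_1 psi z) := derivableP (hpsi z Uz).
  exact: (cder_cont (cderD (cder_cst (gamma : R[i]^o) z)
    (cderM (cder_id z) (cderD dz (cder_cst (- lambda : R[i]^o) z))))).
(* Both conditions are open and hold on the closed disc, hence on a larger one. *)
have [r r1 rV] : exists2 r : R, 1 < r & forall z : R[i]^o, normc z < r -> U z /\ q z != 0.
  apply: (disc_radius (open_neq0 oU cq)) => z z1 /=.
  have zD : closure (@unit_disc R) z := closure_unit_disc z1.
  split; first exact: DU.
  (* At the pole q 0 = gamma is nonzero; elsewhere q z = z (R(z) - lambda), so a zero of [q] would
     make lambda a value of R. *)
  have [->|z0] := eqVneq z 0; first by rewrite /q mul0r addr0.
  apply/eqP => qz0; apply: Rlambda; exists z; first by split=> // /eqP; exact/negP.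
  rewrite /assoc_mero; apply: (mulfI z0); apply/eqP; rewrite -subr_eq0; apply/eqP.
  by rewrite -[RHS]qz0 /q mulrDr mulrCA divff// mulr1 mulrBr addrA.
have dpsi : holo r psi by move=> z /rV[Uz _]; exact: hpsi.
have q0 (z : R[i]^o) : normc z < r -> q z != 0 by move=> /rV[].
have bounded_f := eigen_candidate_Hinfty r1 dpsi q0.
have eigen_f : eigenfunction (toeplitz (symbol gamma psi)) lambda
    (eigen_candidate gamma psi lambda).
  split; first exact: Hinfty_sub_bergman.
    exists 0; last exact: eigen_candidate_neq0.
    by rewrite unit_discE; suff : normc (0 : R[i]^o) < 1 by []; rewrite normc0.
  move=> z; rewrite unit_discE => zD; have z1 : normc z < 1 := zD.
  have z0 := normc_ge0 z.
  have z2 : 0 < 1 + normc z by rewrite ltr_wpDr.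
  (* As |z| < 1, the number 2 / (1 + |z|) exceeds 1 while its product with |z| is below 1. *)
  pose s := Num.min r (2 / (1 + normc z)).
  have s2 : s <= 2 / (1 + normc z) by rewrite ge_min lexx orbT.
  apply: (toeplitz_eigen_candidate r1 dpsi q0 (s := s) z1).
  - by rewrite lt_min r1 ltr_pdivlMr// mul1r ltrD2l.
  - by rewrite ge_min lexx.
  - apply: le_lt_trans (ler_wpM2r z0 s2) _.
    by rewrite mulrAC ltr_pdivrMr// mul1r; lra.
by split=> //; [exists (eigen_candidate gamma psi lambda)|exact: Hinfty_sub_bergman].
Qed.
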